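(* Let $n\ge 1$ and let $S\subset\Bbbk[x_1,\ldots,x_n]$ be a vector subspace which is closed under the substitutions $\circ_p: f(x_1,\ldots,x_n)\mapsto f(p(x_1),\ldots,p(x_n))$ for all polynomials $p\in\Bbbk[x]$ with $p(0)=0$. Then: (1) $S$ is graded by the degree of polynomials: $S=\bigoplus_{d=0}^\infty S_d$, where $S_d$ is the set of elements of $S$ that are homogeneous of degree $d$ (or zero); (2) there is a finite subset $T\subset S$ such that $S$ is generated from $T$ by substitutions $\circ_p$ (with $p\in\Bbbk[x]$, $p(0)=0$) and linear combinations; (3) the generating series $F_S(t):=\sum_{d=0}^\infty(\dim S_d)\,t^d$ is a rational function of $t$.
   Context: $\Bbbk$ is a field of characteristic $0$. ''Generated from $T$ by substitutions and linear combinations'' means that $S$ is the smallest vector subspace of $\Bbbk[x_1,\ldots,x_n]$ that contains $T$ and is closed under all $\circ_p$ with $p(0)=0$. *)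

(* Defs.v *)
From HB Require Import structures.
From mathcomp Require Import all_boot all_order all_algebra.
From mathcomp.multinomials Require Import mpoly.

Set Implicit Arguments.
Unset Strict Implicit.
Unset Printing Implicit Defensive.

Import GRing.Theory.
Local Open Scope ring_scope.

(* Subspaces are Prop-valued predicates, so that membership is not assumed    *)
(* decidable (GRing.submod_closed only speaks about boolean predicates).      *)
Definition is_subspace (k : fieldType) (V : lmodType k) (W : V -> Prop) : Prop :=
  W 0 /\ forall (a : k) (u v : V), W u -> W v -> W (a *: u + v).

(* W is the internal direct sum of the U d: every element of W is a finite    *)
(* sum of elements of the U d, all such sums lie in W, and the sum is direct. *)
Definition is_direct_sum (k : fieldType) (V : lmodType k)
    (W : V -> Prop) (U : nat -> V -> Prop) : Prop :=
  (forall f : V, W f <->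
     exists (m : nat) (g : nat -> V),
       (forall d, U d (g d)) /\ f = \sum_(d < m) g d) /\
  (forall (m : nat) (g : nat -> V),
     (forall d, U d (g d)) -> \sum_(d < m) g d = 0 ->
     forall d, (d < m)%N -> g d = 0).

Definition subst_poly (k : fieldType) (n : nat) (p : {poly k})
    (f : {mpoly k[n]}) : {mpoly k[n]} :=
  f \mPo [tuple (map_poly (@mpolyC n k) p).['X_i] | i < n].

Definition subst_closed (k : fieldType) (n : nat)
    (S : {mpoly k[n]} -> Prop) : Prop :=
  forall (p : {poly k}) (f : {mpoly k[n]}),
    p.[0] = 0 -> S f -> S (subst_poly p f).

(* The smallest subspace containing T and closed under substitutions.         *)
Definition subst_span (k : fieldType) (n : nat) (T : seq {mpoly k[n]})
    (f : {mpoly k[n]}) : Prop :=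
  forall U : {mpoly k[n]} -> Prop,
    is_subspace U -> subst_closed U -> (forall g, g \in T -> U g) -> U f.

(* The zero polynomial is d.-homog for every d.                               *)
Definition homog_part (k : fieldType) (n : nat) (S : {mpoly k[n]} -> Prop)
    (d : nat) (f : {mpoly k[n]}) : Prop :=
  S f /\ f \is d.-homog.

(* The formal power series \sum_d a d * t^d is a quotient P / Q of            *)
(* polynomials, i.e. Q times the series equals P (Cauchy product).            *)
Definition rational_series (K : fieldType) (a : nat -> K) : Prop :=
  exists P Q : {poly K},
    Q != 0 /\ forall d : nat, \sum_(i < d.+1) Q`_i * a (d - i)%N = P`_d.

(* Main.v *)
(* A subspace S closed under substitutions is graded and stable under the     *)
(* operators L_m = sum_i x_i^(m+1) d/dx_i, m > 0.  A suitable combination of  *)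
(* composites of 2n of the L_m, made of terms divisible by high powers of the *)
(* differences x_i - x_j, is multiplication by an arbitrary symmetric multiple*)
(* of B^K composed with a diagonal operator, where B is a symmetric product   *)
(* of the forms x_i and x_i - x_j.  Hence for large N the intersection of S   *)
(* with the ideal (B^N) is a module over the symmetric polynomials, to which  *)
(* Hilbert's basis theorem and the Hilbert-Serre theorem apply.  The quotient *)
(* is filtered by jets along the hyperplanes x_i = 0 and x_i = x_j; these are *)
(* polynomials in one variable less, on which L_m acts with a twist, so one   *)
(* concludes by induction on the number of variables, for all twists at once. *)

Require Import Defs.
From HB Require Import structures.
From mathcomp Require Import all_boot all_order all_algebra.
From mathcomp.multinomials Require Import ssrcomplements mpoly.
From mathcomp Require Import fingroup perm ring zify.
From Stdlib Require Import Classical ClassicalEpsilon.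

Set Implicit Arguments.
Unset Strict Implicit.
Unset Printing Implicit Defensive.

Import GRing.Theory.
Local Open Scope ring_scope.

(** In characteristic 0 the coefficients of a polynomial in [t] are linear combinations of its
    values at 0, 1, 2, ... ([polynomial_values_coef]). For the substitutions x -> t x this gives the
    grading, for x -> x + t x^(m+1) stability under [witt m] ([subst_closed_witt]). Finite
    generation and rationality then follow from [witt_noetherian]: for the operators sum_i x_i^m
    (x_i d/dx_i + u_i + w_i m), m > 0, with any natural u and w, ascending chains of graded stable
    subspaces become stationary and Hilbert series are rational.

    This is proved by induction on the number of variables. Let l be x_i or x_i - x_j. The quotient
    of S cap (l^s) by S cap (l^(s+1)) restricts to a stable subspace in one variable less, for other
    u and w ([jets_closed]). So S may be replaced by its intersection with the ideals of powers of
    such l ([stabilizes_of_jets], [rational_of_jets]). In particular its elements may be taken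
    divisible by every x_i, and then weights w_i = 1 can be traded for w_i = 0
    ([twisted_witt_untwist]).

    Now let no w_i be 1. Combine the composites L_(m_1) ... L_(m_n) with the coefficients of a
    symmetric Q vanishing to order n+1 on the diagonals: only the terms in which the operators act
    on distinct variables survive ([isolated_in_closed]). Compose two such operators, with Q and Q'
    multiplied by complementary powers b and r - b of x_1 ... x_n; the coefficient of b^r is
    multiplication by a symmetric polynomial after a diagonal operator D ([shift_coef_top]). Hence
    B^K P D f lies in S for all f in S and all symmetric P ([arrangement_in_closed]). Since D is a
    differential operator of finite order with nonzero eigenvalues on monomials divisible by all
    variables, it can be removed at the price of a higher power of B that depends on f
    ([sym_radical_mem]). Noetherianity over the symmetric polynomials makes this power uniform
    ([sym_part_recover]): S cap (B^J) is B^J times a module over them, and the theorems of Hilbert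
    and Hilbert-Serre apply. *)

Section Subspaces.
Variables (k : fieldType) (V : lmodType k) (W : V -> Prop).
Hypothesis subW : is_subspace W.

Lemma subspace0 : W 0. Proof. by case: subW. Qed.

Lemma subspaceZ a u : W u -> W (a *: u).
Proof. by case: subW => W0 WS Wu; rewrite -[a *: u]addr0; apply: WS. Qed.

Lemma subspaceD u v : W u -> W v -> W (u + v).
Proof. by case: subW => W0 WS Wu Wv; rewrite -[u]scale1r; apply: WS. Qed.

Lemma subspaceN u : W u -> W (- u).
Proof. by move=> Wu; rewrite -scaleN1r; apply: subspaceZ. Qed.

Lemma subspaceB u v : W u -> W v -> W (u - v).
Proof. by move=> Wu Wv; apply: subspaceD => //; apply: subspaceN. Qed.

Lemma subspace_sum (I : eqType) (r : seq I) (P : pred I) (F : I -> V) :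
  (forall i, i \in r -> P i -> W (F i)) -> W (\sum_(i <- r | P i) F i).
Proof.
move=> WF; rewrite big_seq_cond; elim/big_ind: _ => //.
- exact: subspace0.
- exact: subspaceD.
by move=> i /andP[ri Pi]; apply: WF.
Qed.

Lemma subspace_scale_cancel a u : a != 0 -> W (a *: u) -> W u.
Proof.
by move=> a0 /(subspaceZ a^-1); rewrite scalerA mulVf // scale1r.
Qed.

End Subspaces.

(** * Vandermonde extraction and finite-dimensional linear algebra *)

Lemma char0_natr_eq0 (k : fieldType) (k0 : [pchar k] =i pred0) (m : nat) :
  (m%:R == 0 :> k) = (m == 0)%N.
Proof. by move/pcharf0P: k0 => ->. Qed.

Lemma char0_natr_inj (k : fieldType) (k0 : [pchar k] =i pred0) :
  injective (fun m : nat => m%:R : k).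
Proof.
suff inj a b : (a <= b)%N -> a%:R = b%:R :> k -> a = b.
  by move=> a b E; case: (leqP a b) => [|/ltnW] ab; [|symmetry]; apply: inj.
move=> ab /eqP; rewrite -subr_eq0 -opprB oppr_eq0 -natrB //.
by rewrite char0_natr_eq0 // subn_eq0 => ba; apply/eqP; rewrite eqn_leq ab.
Qed.

(* Invertibility of the Vandermonde matrix of the nodes 0, ..., N-1.          *)
Lemma polynomial_values_coef (k : fieldType) (k0 : [pchar k] =i pred0)
    (V : lmodType k) (W : V -> Prop) (subW : is_subspace W)
    (N : nat) (c : nat -> V) :
  (forall a : nat, (a < N)%N -> W (\sum_(j < N) (a%:R ^+ j) *: c j)) ->
  forall j, (j < N)%N -> W (c j).
Proof.
move=> Wv j jN; pose A := Vandermonde N (\row_(i < N) (i%:R : k)).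
have AE (b a : 'I_N) : A b a = (a : nat)%:R ^+ b by rewrite !mxE.
have uA : A \in unitmx.
  rewrite unitmxE unitfE det_Vandermonde; apply/prodf_neq0 => a _.
  apply/prodf_neq0 => b ab; rewrite !mxE subr_eq0; apply/eqP.
  by move/(char0_natr_inj k0) => E; rewrite E ltnn in ab.
suff -> : c j = \sum_(a < N) invmx A a (Ordinal jN)
                   *: (\sum_(i < N) ((a : nat)%:R ^+ i) *: c i).
  by apply: subspace_sum => // a _ _; apply: subspaceZ => //; apply: Wv.
under eq_bigr do rewrite scaler_sumr.
rewrite exchange_big /= (bigD1 (Ordinal jN)) //= [X in _ + X]big1 ?addr0.
  rewrite -[LHS]scale1r; under eq_bigr do rewrite scalerA.
  rewrite -scaler_suml; congr (_ *: _).
  have := congr1 (fun M : 'M_N => M (Ordinal jN) (Ordinal jN)) (mulmxV uA).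
  rewrite mxE mxE eqxx mulr1n => E; rewrite -[LHS]E; apply: eq_bigr => a _.
  by rewrite AE mulrC.
move=> i ij; under eq_bigr do rewrite scalerA.
rewrite -scaler_suml.
have := congr1 (fun M : 'M_N => M i (Ordinal jN)) (mulmxV uA).
rewrite mxE mxE (negbTE ij) mulr0n => E; rewrite (_ : \sum_(_ < _) _ = 0) ?scale0r //.
by rewrite -[RHS]E; apply: eq_bigr => a _; rewrite AE mulrC.
Qed.

(** Adjoin vectors of [W] to a subspace as long as some are missing; the dimension of [A] bounds the
    number of steps. *)
Lemma vspace_of_subspace (k : fieldType) (A : vectType k) (W : A -> Prop) :
  is_subspace W -> exists U : {vspace A}, forall v, v \in U <-> W v.
Proof.
move=> subW.
suff grow m (U : {vspace A}) : (\dim {:A} - \dim U <= m)%N ->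
    (forall v, v \in U -> W v) -> exists U : {vspace A}, forall v, v \in U <-> W v.
  apply: (grow _ 0%VS (leqnn _)) => v; rewrite memv0 => /eqP->.
  exact: subspace0.
elim: m U => [|m IH] U dU UW.
  exists U => v; split; first exact: UW.
  suff -> : U = fullv by rewrite memvf.
  by apply/eqP; rewrite eqEdim subvf -subn_eq0 -leqn0.
case: (classic (exists v, W v /\ v \notin U)) => [[v [Wv vU]]|no].
  apply: (IH (U + <[v]>)%VS); last first.
    move=> _ /memv_addP[x xU [_ /vlineP[a ->] ->]].
    by apply: subspaceD => //; [apply: UW|apply: subspaceZ].
  have lt : (\dim U < \dim (U + <[v]>))%N.
    rewrite ltn_neqAle dimvS ?addvSl // andbT.
    apply: contra vU => /eqP E.
    have /eqP-> : U == (U + <[v]>)%VS by rewrite eqEdim addvSl E leqnn.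
    by apply: (subvP (addvSr _ _)); apply: memv_line.
  have := dimvS (subvf (U + <[v]>)%VS); lia.
exists U => v; split; first exact: UW.
by move=> Wv; apply: contraT => vU; case: no; exists v.
Qed.

Definition vspace_of (k : fieldType) (A : vectType k) (W : A -> Prop) : {vspace A} :=
  epsilon (inhabits 0%VS) (fun U => forall v, v \in U <-> W v).

Lemma vspace_ofP (k : fieldType) (A : vectType k) (W : A -> Prop) :
  is_subspace W -> forall v, v \in vspace_of W <-> W v.
Proof.
by move=> /vspace_of_subspace ex; apply: (epsilon_spec (inhabits 0%VS) _ ex).
Qed.

Section DimensionTransfer.
(* A and B are finite-dimensional models of parts of V and V'.                *)
Variables (k : fieldType) (V V' : lmodType k) (A B : vectType k).
Variables (tau : {linear A -> V}) (tau' : {linear B -> V'}).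
Variable (sigma' : {linear V' -> B}).
Hypothesis tau_inj : injective tau.
Hypothesis tau'_inj : injective tau'.
Variable (phi : {linear V -> V'}).

Lemma rank_nullity_vspace (U K : {vspace A}) (I : {vspace B}) :
  (forall a, a \in U -> tau' (sigma' (phi (tau a))) = phi (tau a)) ->
  (forall a, a \in K <-> a \in U /\ phi (tau a) = 0) ->
  (forall b, b \in I <-> exists2 a, a \in U & tau' b = phi (tau a)) ->
  \dim U = (\dim K + \dim I)%N.
Proof.
move=> back defK defI.
pose F : 'Hom(A, B) := linfun (sigma' \o (phi \o tau)).
have FE a : F a = sigma' (phi (tau a)) by rewrite lfunE.
rewrite -(limg_ker_dim F U); congr (_ + _)%N; congr (dimv _).
  apply/vspaceP => a; rewrite memv_cap memv_ker FE.
  apply/andP/idP => [[aU /eqP E]|/defK[aU E]].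
    by apply/defK; split => //; rewrite -back // E linear0.
  by rewrite aU E linear0.
apply/vspaceP => b; apply/idP/idP.
  move=> /memv_imgP[a aU ->]; apply/defI; exists a => //.
  by rewrite FE back.
move=> /defI[a aU E]; apply/memv_imgP; exists a => //.
by apply: tau'_inj; rewrite E FE back.
Qed.

End DimensionTransfer.

(** * Hilbert functions of graded subspaces *)

Local Notation "d .-hom" := (ishomog1 d mdeg) (at level 1, format "d .-hom") : form_scope.

Section HomogeneousModel.
Variables (k : fieldType) (n : nat).
Local Notation V := {mpoly k[n]}.

(** A model of the polynomials of degree at most [d] that covers [n = 0], which the induction on the
    number of variables reaches. *)
Definition bounded_coefs (d : nat) : Type := {ffun 'X_{1..n < d.+1} -> k^o}.
HB.instance Definition _ d := Vector.on (bounded_coefs d).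

Definition poly_of_coefs (d : nat) (v : bounded_coefs d) : V :=
  \sum_(m : 'X_{1..n < d.+1}) v m *: 'X_[m].

Definition coefs_of_poly (d : nat) (f : V) : bounded_coefs d :=
  [ffun m : 'X_{1..n < d.+1} => f@_m].

Lemma poly_of_coefs_linear d : linear (@poly_of_coefs d).
Proof.
move=> a u v; rewrite /poly_of_coefs scaler_sumr -big_split /=.
by apply: eq_bigr => m _; rewrite !ffunE scalerDl scalerA.
Qed.
HB.instance Definition _ d :=
  GRing.isLinear.Build k (bounded_coefs d) V _ (@poly_of_coefs d)
    (@poly_of_coefs_linear d).

Lemma coefs_of_poly_linear d : linear (@coefs_of_poly d).
Proof. by move=> a u v; apply/ffunP => m; rewrite !ffunE mcoeffD mcoeffZ. Qed.
HB.instance Definition _ d :=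
  GRing.isLinear.Build k V (bounded_coefs d) _ (@coefs_of_poly d)
    (@coefs_of_poly_linear d).

Lemma coefs_of_polyK d (f : V) : f \is d.-hom -> poly_of_coefs (coefs_of_poly d f) = f.
Proof.
move=> hf; rewrite [RHS](mpolywE (k := d.+1)); last first.
  rewrite msizeE; apply/bigmax_leqP_seq => m mf _.
  by rewrite ltnS (dhomog_mf hf mf).
by apply: eq_bigr => m _; rewrite ffunE.
Qed.

Lemma mcoeff_poly_of_coefs d v (m : 'X_{1..n < d.+1}) : (@poly_of_coefs d v)@_m = v m.
Proof.
rewrite raddf_sum (bigD1 m) //= mcoeffZ mcoeffX eqxx mulr1 big1 ?addr0 // => m' ne.
by rewrite mcoeffZ mcoeffX -bmeqP (negbTE ne) mulr0.
Qed.

Lemma poly_of_coefs_inj d : injective (@poly_of_coefs d).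
Proof. by move=> u v E; apply/ffunP => m; rewrite -!mcoeff_poly_of_coefs E. Qed.

End HomogeneousModel.

Definition homog_vspace (k : fieldType) (n : nat) (W : {mpoly k[n]} -> Prop) (d : nat) :
    {vspace bounded_coefs k n d} :=
  vspace_of (fun v => homog_part W d (poly_of_coefs v)).

Definition hilbert (k : fieldType) (n : nat) (W : {mpoly k[n]} -> Prop) (d : nat) : nat :=
  \dim (homog_vspace W d).

Lemma homog_part_subspace (k : fieldType) (n : nat) (W : {mpoly k[n]} -> Prop) d :
  is_subspace W -> is_subspace (homog_part W d).
Proof.
move=> [W0 WS]; split; first by split=> //; apply: rpred0.
move=> a u v [Wu hu] [Wv hv]; split; first exact: WS.
by apply: rpredD => //; apply: rpredZ.
Qed.

Lemma hilbert_memP (k : fieldType) (n : nat) (W : {mpoly k[n]} -> Prop) d :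
  is_subspace W -> forall v : bounded_coefs k n d,
  v \in homog_vspace W d <->
  homog_part W d (poly_of_coefs v).
Proof.
move=> subW; apply: vspace_ofP; split.
  by rewrite linear0; apply: subspace0; apply: homog_part_subspace.
move=> a u v Wu Wv; rewrite linearP /=.
by case: (homog_part_subspace d subW) => _; apply.
Qed.

Section Hilbert.
Variables (k : fieldType) (n : nat).
Implicit Types (W K : {mpoly k[n]} -> Prop).

Lemma hilbert_rank_nullity n' (phi : {linear {mpoly k[n]} -> {mpoly k[n']}})
    W K (I : {mpoly k[n']} -> Prop) d d' :
  is_subspace W -> is_subspace K -> is_subspace I ->
  (forall f, homog_part K d f <-> homog_part W d f /\ phi f = 0) ->
  (forall g, homog_part I d' g <-> exists2 f, homog_part W d f & g = phi f) ->
  hilbert W d = (hilbert K d + hilbert I d')%N.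
Proof.
move=> sW sK sI defK defI.
apply: (@rank_nullity_vspace _ _ _ _ _ (@poly_of_coefs k n d) (@poly_of_coefs k n' d')
  (@coefs_of_poly k n' d') (@poly_of_coefs_inj k n' d') phi).
- move=> a /hilbert_memP-/(_ sW) Wa /=; apply: coefs_of_polyK.
  by have /defI[] : exists2 f, homog_part W d f & phi (poly_of_coefs a) = phi f
    by exists (poly_of_coefs a).
- move=> a; split=> [/hilbert_memP-/(_ sK)/defK[Wa E]|[/hilbert_memP-/(_ sW) Wa E]].
    by split=> //; apply/hilbert_memP.
  by apply/hilbert_memP => //; apply/defK.
move=> b; split=> [/hilbert_memP-/(_ sI)/defI[f Wf E]|[a /hilbert_memP-/(_ sW) Wa E]].
  have fE := coefs_of_polyK (proj2 Wf).
  by exists (coefs_of_poly d f); rewrite /= ?fE //; apply/hilbert_memP; rewrite ?fE.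
by apply/hilbert_memP => //; apply/defI; exists (poly_of_coefs a).
Qed.

Lemma eq_hilbert W K d : is_subspace W -> is_subspace K ->
  (forall f, homog_part W d f <-> homog_part K d f) -> hilbert W d = hilbert K d.
Proof.
move=> sW sK E; congr (dimv _); apply/vspaceP => v.
by apply/idP/idP => /hilbert_memP H; apply/hilbert_memP => //; apply/E; apply: H.
Qed.

Lemma hilbert0 W d : is_subspace W -> (forall f, homog_part W d f -> f = 0) ->
  hilbert W d = 0%N.
Proof.
move=> sW W0; apply/eqP; rewrite dimv_eq0 -subv0; apply/subvP => v.
move=> /hilbert_memP-/(_ sW)/W0 E; rewrite memv0; apply/eqP.
by apply: (@poly_of_coefs_inj k n d); rewrite E linear0.
Qed.

Lemma zero_subspace (V : lmodType k) : is_subspace (fun f : V => f = 0).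
Proof. by split=> // a u v -> ->; rewrite scaler0 addr0. Qed.

Lemma hilbert_inj n' (phi : {linear {mpoly k[n]} -> {mpoly k[n']}})
    W (I : {mpoly k[n']} -> Prop) d d' :
  is_subspace W -> is_subspace I ->
  (forall f, W f -> phi f = 0 -> f = 0) ->
  (forall g, homog_part I d' g <-> exists2 f, homog_part W d f & g = phi f) ->
  hilbert I d' = hilbert W d.
Proof.
move=> sW sI inj defI; rewrite (@hilbert_rank_nullity n' phi W (fun f => f = 0) I d d') //.
- by rewrite hilbert0 // => [|f []] //; apply: zero_subspace.
- exact: zero_subspace.
move=> f; split=> [[-> h]|[[Wf h] /(inj _ Wf)]]; last by [].
by rewrite linear0; do !split=> //; apply: subspace0.
Qed.

Lemma hilbert_sum_cap (A B C D : {mpoly k[n]} -> Prop) d :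
  is_subspace A -> is_subspace B -> is_subspace C -> is_subspace D ->
  (forall f, homog_part C d f <->
     exists a b, [/\ homog_part A d a, homog_part B d b & f = a + b]) ->
  (forall f, homog_part D d f <-> homog_part A d f /\ homog_part B d f) ->
  (hilbert C d + hilbert D d = hilbert A d + hilbert B d)%N.
Proof.
move=> sA sB sC sD defC defD; apply: esym; rewrite -dimv_sum_cap; apply: esym.
congr (_ + _)%N; congr (dimv _); apply/vspaceP => v; apply/idP/idP.
- move=> /hilbert_memP-/(_ sC)/defC[a [b [Aa Bb E]]].
  have aE := coefs_of_polyK (proj2 Aa); have bE := coefs_of_polyK (proj2 Bb).
  have -> : v = coefs_of_poly d a + coefs_of_poly d b.
    by apply: (@poly_of_coefs_inj k n d); rewrite linearD /= aE bE.
  by apply: memv_add; apply/hilbert_memP => //; rewrite ?aE ?bE.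
- move=> /memv_addP[a /hilbert_memP-/(_ sA) Aa [b /hilbert_memP-/(_ sB) Bb ->]].
  by apply/hilbert_memP => //; apply/defC; rewrite linearD;
    exists (poly_of_coefs a), (poly_of_coefs b).
- move=> /hilbert_memP-/(_ sD)/defD[Av Bv]; rewrite memv_cap.
  by apply/andP; split; apply/hilbert_memP.
rewrite memv_cap => /andP[/hilbert_memP-/(_ sA) Av /hilbert_memP-/(_ sB) Bv].
by apply/hilbert_memP => //; apply/defD.
Qed.

Lemma hilbert_le W K d : is_subspace W -> is_subspace K ->
  (forall f, homog_part W d f -> K f) -> (hilbert W d <= hilbert K d)%N.
Proof.
move=> sW sK WK; apply/dimvS/subvP => v /hilbert_memP-/(_ sW) [Wv hv].
by apply/hilbert_memP => //; split=> //; apply: WK.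
Qed.

Lemma hilbert_le_eq W K d : is_subspace W -> is_subspace K ->
  (forall f, homog_part W d f -> K f) -> (hilbert K d <= hilbert W d)%N ->
  forall f, homog_part K d f -> W f.
Proof.
move=> sW sK WK le f Kf.
have sub : (homog_vspace W d <=
       homog_vspace K d)%VS.
  apply/subvP => v /hilbert_memP-/(_ sW) [Wv hv].
  by apply/hilbert_memP => //; split=> //; apply: WK.
have fE := coefs_of_polyK (proj2 Kf).
have fW : coefs_of_poly d f \in homog_vspace W d.
  have /eqP-> : homog_vspace W d == homog_vspace K d by rewrite eqEdim sub.
  by apply/hilbert_memP; rewrite ?fE.
by move/hilbert_memP: fW => /(_ sW); rewrite fE => -[].
Qed.

End Hilbert.

(** Links the coefficient model of the induction to the type [dhomog] of the final statement. *)
Lemma hilbert_dimv (k : fieldType) (n d : nat) (S : {mpoly k[n.+1]} -> Prop)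
    (U : {vspace dhomog n.+1 k d}) : is_subspace S ->
  (forall v, v \in U <-> homog_part S d (mpoly_of_dhomog v)) -> \dim U = hilbert S d.
Proof.
move=> sS defU.
rewrite (@rank_nullity_vspace k _ _ _ _ (@mpoly_of_dhomog n.+1 k d)
  (@poly_of_coefs k n.+1 d) (@coefs_of_poly k n.+1 d) (@poly_of_coefs_inj k n.+1 d)
  idfun U 0%VS (homog_vspace S d)).
- by rewrite dimv0.
- by move=> a _ /=; apply: coefs_of_polyK; apply/dhomog_is_dhomog.
- move=> a; rewrite memv0 /=; split=> [/eqP->|[_ E]].
    by rewrite linear0 mem0v.
  by apply/eqP/val_inj.
move=> b; split=> [/hilbert_memP-/(_ sS) Sb|[a /defU Sa E]].
  by exists (DHomog (proj2 Sb)) => //; apply/defU.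
by apply/hilbert_memP => //; rewrite E.
Qed.

(** * Rational series, Noetherian modules and the Hilbert-Serre theorem *)

Section RationalSeries.
Variable K : fieldType.
Implicit Types (a b c : nat -> K) (P Q : {poly K}).

Definition cauchy Q a d := \sum_(i < d.+1) Q`_i * a (d - i)%N.

Lemma cauchy_trunc Q a d N : (d < N)%N -> cauchy Q a d = (Q * \poly_(i < N) a i)`_d.
Proof.
move=> dN; rewrite coefM; apply: eq_bigr => i _; congr (_ * _).
by rewrite coef_poly (leq_ltn_trans (leq_subr _ _) dN).
Qed.

Lemma cauchyM Q1 Q2 a d : cauchy (Q1 * Q2) a d = cauchy Q1 (cauchy Q2 a) d.
Proof.
rewrite (cauchy_trunc _ _ (ltnSn d)) -mulrA coefM; apply: eq_bigr => i _.
by congr (_ * _); rewrite -cauchy_trunc // ltnS leq_subr.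
Qed.

Lemma cauchyC (x : K) a d : cauchy x%:P a d = x * a d.
Proof. by rewrite (cauchy_trunc _ _ (ltnSn d)) coefCM coef_poly ltnSn. Qed.

Lemma cauchy_coef Q P d : cauchy Q (fun i => P`_i) d = (Q * P)`_d.
Proof. by rewrite coefM. Qed.

Lemma eq_cauchy Q a b : a =1 b -> cauchy Q a =1 cauchy Q b.
Proof. by move=> E d; apply: eq_bigr => i _; rewrite E. Qed.

Lemma cauchyD Q a b d : cauchy Q (fun i => a i + b i) d = cauchy Q a d + cauchy Q b d.
Proof. by rewrite /cauchy -big_split; apply: eq_bigr => i _; rewrite mulrDr. Qed.

Lemma cauchyN Q a d : cauchy Q (fun i => - a i) d = - cauchy Q a d.
Proof. by rewrite /cauchy -sumrN; apply: eq_bigr => i _; rewrite mulrN. Qed.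

Lemma cauchyDl Q1 Q2 a d : cauchy (Q1 + Q2) a d = cauchy Q1 a d + cauchy Q2 a d.
Proof. by rewrite /cauchy -big_split; apply: eq_bigr => i _; rewrite coefD mulrDl. Qed.

Definition shift_series s a d := if (s <= d)%N then a (d - s)%N else 0.

Lemma cauchyXn s a d : cauchy 'X^s a d = shift_series s a d.
Proof.
rewrite (cauchy_trunc _ _ (ltnSn d)) coefXnM /shift_series.
by case: leqP => // sd; rewrite coef_poly ltnS leq_subr.
Qed.

Lemma rational_seriesP a : rational_series a <->
  exists P Q, Q != 0 /\ forall d, cauchy Q a d = P`_d.
Proof. by []. Qed.

Lemma eq_rational_series a b : a =1 b -> rational_series a -> rational_series b.
Proof.
by move=> E [P [Q [Q0 QP]]]; exists P, Q; split=> // d; rewrite -QP; apply: eq_cauchy.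
Qed.

Lemma rational_seriesD a b :
  rational_series a -> rational_series b -> rational_series (fun d => a d + b d).
Proof.
move=> [P [Q [Q0 QP]]] [P' [Q' [Q'0 QP']]]; apply/rational_seriesP.
exists (Q' * P + Q * P'), (Q * Q'); split=> [|d]; first by rewrite mulf_neq0.
rewrite cauchyD {1}[Q * Q']mulrC !cauchyM coefD.
by rewrite (eq_cauchy _ QP) (eq_cauchy _ QP') !cauchy_coef.
Qed.

Lemma rational_seriesN a : rational_series a -> rational_series (fun d => - a d).
Proof.
move=> [P [Q [Q0 QP]]]; apply/rational_seriesP; exists (- P), Q; split=> // d.
by rewrite cauchyN coefN -QP.
Qed.

Lemma rational_seriesB a b :
  rational_series a -> rational_series b -> rational_series (fun d => a d - b d).
Proof. by move=> ra /rational_seriesN; apply: rational_seriesD. Qed.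

Lemma rational_series_shift s a : rational_series a -> rational_series (shift_series s a).
Proof.
move=> [P [Q [Q0 QP]]]; apply/rational_seriesP; exists ('X^s * P), Q; split=> // d.
by rewrite -(eq_cauchy _ (cauchyXn s a)) -cauchyM mulrC cauchyM (eq_cauchy _ QP) cauchy_coef.
Qed.

Lemma rational_series_finite J a : (forall d, (J <= d)%N -> a d = 0) -> rational_series a.
Proof.
move=> a0; apply/rational_seriesP; exists (\poly_(i < J) a i), 1; split=> [|d].
  exact: oner_neq0.
by rewrite -polyC1 cauchyC mul1r coef_poly; case: ltnP => // /a0.
Qed.

(** The hypothesis says that 1 - t^e times the series of [a] is the series of [c]. *)
Lemma rational_series_recurrence e a c : (0 < e)%N ->
  (forall d, a d = c d + shift_series e a d) -> rational_series c -> rational_series a.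
Proof.
move=> e0 ac [P [Q [Q0 QP]]]; apply/rational_seriesP; exists P, (Q * (1 - 'X^e)).
split=> [|d].
  rewrite mulf_neq0 //; apply/eqP => /(congr1 (fun p : {poly K} => p`_0)).
  rewrite coefB coef1 coefXn coef0 eqxx eq_sym (gtn_eqF e0) subr0.
  by apply/eqP; apply: oner_neq0.
rewrite cauchyM -[RHS]QP; apply: eq_cauchy => i.
rewrite cauchyDl -polyC1 cauchyC mul1r.
have -> : cauchy (- 'X^e) a i = - cauchy 'X^e a i.
  by rewrite /cauchy -sumrN; apply: eq_bigr => j _; rewrite coefN mulNr.
by rewrite cauchyXn {1}ac addrK.
Qed.

End RationalSeries.

(** * Ascending chains *)

Section Chains.
Variable V : Type.

Definition increasing (S : nat -> V -> Prop) := forall j f, S j f -> S j.+1 f.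

Definition stabilizes (S : nat -> V -> Prop) := exists J, forall j f, S j f -> S J f.

Lemma increasing_le S j l f : increasing S -> (j <= l)%N -> S j f -> S l f.
Proof. by move=> incS /subnK <-; elim: (l - j)%N => // i IH /IH; apply: incS. Qed.

End Chains.

Lemma bounded_nondecreasing (h : nat -> nat) B :
  (forall j l, (j <= l)%N -> (h j <= h l)%N) -> (forall j, (h j <= B)%N) ->
  exists J, forall j, (h j <= h J)%N.
Proof.
move=> inc bd; suff [J HJ] : exists J, forall j, (J <= j)%N -> (h j <= h J)%N.
  exists J => j; case: (leqP J j) => [/HJ //|/ltnW]; exact: inc.
suff gen m j0 : (B - h j0 <= m)%N -> exists J, forall j, (J <= j)%N -> (h j <= h J)%N.
  exact: (gen _ 0%N (leqnn _)).
elim: m j0 => [|m IH] j0 Hm.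
  by exists j0 => j _; apply: leq_trans (bd j) _; rewrite -subn_eq0 -leqn0.
case: (classic (exists2 j, (j0 <= j)%N & (h j0 < h j)%N)) => [[j _ lt]|no].
  by apply: (IH j); have := bd j; lia.
by exists j0 => j j0j; rewrite leqNgt; apply/negP => lt; case: no; exists j.
Qed.

Lemma finite_max_witness (P : nat -> nat -> Prop) (N : nat) :
  (forall i J J', (J <= J')%N -> P i J -> P i J') ->
  (forall i, (i < N)%N -> exists J, P i J) ->
  exists J, forall i, (i < N)%N -> P i J.
Proof.
move=> mono; elim: N => [|N IH] ex; first by exists 0%N.
have [J HJ] := IH (fun i iN => ex i (ltnW iN)).
have [J' HJ'] := ex N (ltnSn N).
exists (maxn J J') => i; rewrite ltnS leq_eqVlt => /orP[/eqP->|/HJ].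
  exact: mono (leq_maxr _ _) HJ'.
exact: mono (leq_maxl _ _).
Qed.

(** * Graded submodules: chain condition and Hilbert series *)

Section Graded.
Variables (k : fieldType) (n : nat).
Local Notation V := {mpoly k[n]}.
Implicit Types (W U : V -> Prop) (f g t : V).

Definition graded_subspace W :=
  is_subspace W /\ forall d f, W f -> W (pihomog mdeg d f).

Lemma pihomogM t e d f : t \is e.-hom ->
  pihomog mdeg d (t * f) = if (e <= d)%N then t * pihomog mdeg (d - e) f else 0.
Proof.
move=> ht; elim/mpolyind: f => [|c m p _ _ IH].
  by rewrite mulr0 !pihomog0 mulr0 if_same.
rewrite mulrDr !linearD /= IH -scalerAr !linearZ /= pihomogX.
have hm : t * 'X_[m] \is (e + mdeg m).-hom by apply: dhomogM => //; rewrite dhomogX.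
case: leqP => ed; last first.
  have ne : (e + mdeg m)%N != d by apply: contraTneq ed => <-; rewrite -leqNgt leq_addr.
  by rewrite addr0 (pihomog_ne0 ne hm) scaler0.
rewrite mulrDr -scalerAr; congr (_ *: _ + _); case: eqP => E.
  have dE : d = (e + mdeg m)%N by rewrite E subnKC.
  by rewrite pihomog_dE // dE.
have ne : (e + mdeg m)%N != d by apply/eqP => dE; apply: E; rewrite -dE addKn.
by rewrite mulr0 (pihomog_ne0 ne hm).
Qed.

Definition mul_by t f := t * f.

Lemma mul_by_linear t : linear (mul_by t).
Proof. by move=> a u v; rewrite /mul_by mulrDr scalerAr. Qed.
HB.instance Definition _ t := GRing.isLinear.Build k V V _ (mul_by t) (mul_by_linear t).

Lemma hilbert_mul t e W I d : t != 0 -> t \is e.-hom -> graded_subspace W -> is_subspace I ->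
  (forall f, I f <-> exists2 g, W g & f = t * g) -> hilbert I (d + e) = hilbert W d.
Proof.
move=> t0 ht [sW hW] sI defI; apply: (hilbert_inj (phi := mul_by t)) => //.
  by move=> f _ /eqP; rewrite mulf_eq0 (negbTE t0) => /eqP.
move=> g; split=> [[/defI[f Wf ->] hg]|[f [Wf hf] ->]]; last first.
  by split; [apply/defI; exists f|rewrite addnC; apply: dhomogM].
exists (pihomog mdeg d f); first by split; [apply: hW|apply: pihomogP].
by rewrite -(pihomog_dE hg) (pihomogM _ _ ht) leq_addl addnK.
Qed.

Lemma graded_mem_sum W f : is_subspace W -> (forall d, W (pihomog mdeg d f)) -> W f.
Proof.
move=> sW Wd; rewrite [f](pihomog_partitionE (mf := mdeg) (leqnn (msize f))).
by apply: subspace_sum.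
Qed.

Lemma stabilizes_in_degree (S : nat -> V -> Prop) d : increasing S ->
  (forall j, is_subspace (S j)) ->
  exists J, forall j f, homog_part (S j) d f -> S J f.
Proof.
move=> incS sS; have [] := @bounded_nondecreasing (fun j => hilbert (S j) d)
  (\dim {: bounded_coefs k n d}).
- by move=> j l jl; apply: hilbert_le => // f [/(increasing_le incS jl)].
- by move=> j; apply: dimvS; apply: subvf.
move=> J HJ; exists J => j f Sf.
have le1 : (hilbert (S (maxn J j)) d <= hilbert (S J) d)%N by apply: HJ.
apply: (hilbert_le_eq (sS J) (sS (maxn J j)) _ le1).
  by move=> g [/(increasing_le incS (leq_maxl J j))].
by case: Sf => Sf hf; split=> //; apply: increasing_le incS (leq_maxr J j) Sf.
Qed.

Definition mul_closed (ts : seq V) W := forall t, t \in ts -> forall f, W f -> W (t * f).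

(** The chain condition for graded submodules of [W / U] over the algebra generated by [ts], stated
    without forming the quotient. *)
Definition noetherian (ts : seq V) W U := forall N : nat -> V -> Prop,
  increasing N -> (forall j, graded_subspace (N j)) -> (forall j, mul_closed ts (N j)) ->
  (forall j f, U f -> N j f) -> (forall j f, N j f -> W f) -> stabilizes N.

Definition add_mul U t W f := exists u w, [/\ U u, W w & f = u + t * w].

Lemma graded_add_mul U t W e : t \is e.-hom -> graded_subspace U -> graded_subspace W ->
  graded_subspace (add_mul U t W).
Proof.
move=> ht [sU gU] [sW gW]; split; [split|].
- by exists 0, 0; rewrite mulr0 addr0; split=> //; apply: subspace0.
- move=> a _ _ [u [w [Uu Ww ->]]] [u' [w' [Uu' Ww' ->]]].
  exists (a *: u + u'), (a *: w + w'); split; [by case: sU => _; apply|by case: sW => _; apply|].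
  by rewrite mulrDr scalerDr scalerAr addrACA.
move=> d _ [u [w [Uu Ww ->]]]; rewrite linearD /= (pihomogM _ _ ht).
case: leqP => _; last by exists (pihomog mdeg d u), 0; rewrite mulr0; split=> //;
  [apply: gU|apply: subspace0].
by exists (pihomog mdeg d u), (pihomog mdeg (d - e) w); split=> //; [apply: gU|apply: gW].
Qed.

(* The submodules {m | t^i m \in N} + tW grow with i; once they are           *)
(* stationary, N is recovered from them by induction on the degree.           *)
Lemma noetherian_cons t e ts W U : (0 < e)%N -> t \is e.-hom ->
  graded_subspace W -> mul_closed (t :: ts) W ->
  noetherian ts W (add_mul U t W) -> noetherian (t :: ts) W U.
Proof.
move=> e0 ht gW cW acc N incN gN cN UN NW.
have [sW hW] := gW.
have tiN i j f : N j f -> N j (t ^+ i * f).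
  move=> Nf; elim: i => [|i IH]; first by rewrite expr0 mul1r.
  by rewrite exprS -mulrA; apply: cN => //; apply: mem_head.
pose Q i j m := exists m' w, [/\ W m', N j (t ^+ i * m'), W w & m = m' + t * w].
have Q_incj i j l m : (j <= l)%N -> Q i j m -> Q i l m.
  move=> jl [m' [w [Wm' Nm' Ww ->]]]; exists m', w; split=> //.
  exact: increasing_le incN jl Nm'.
have Q_inci i l j m : (i <= l)%N -> Q i j m -> Q l j m.
  move=> il [m' [w [Wm' Nm' Ww ->]]]; exists m', w; split=> //.
  by rewrite -(subnK il) exprD -mulrA; apply: tiN.
have hti i : t ^+ i \is (e * i).-hom by apply: dhomogMn.
have gQ i j : graded_subspace (Q i j).
  have [sN hN] := gN j.
  split; [split|].
  - exists 0, 0; rewrite !mulr0 addr0; split=> //; exact: subspace0.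
  - move=> a _ _ [m1 [w1 [Wm1 Nm1 Ww1 ->]]] [m2 [w2 [Wm2 Nm2 Ww2 ->]]].
    exists (a *: m1 + m2), (a *: w1 + w2).
    split; [by case: sW => _; apply| | by case: sW => _; apply|].
      by rewrite mulrDr -scalerAr; case: sN => _; apply.
    by rewrite mulrDr scalerDr scalerAr addrACA.
  move=> d _ [m [w [Wm Nm Ww ->]]]; rewrite linearD /= (pihomogM _ _ ht).
  have Nd : N j (t ^+ i * pihomog mdeg d m).
    by have := hN (e * i + d)%N _ Nm; rewrite (pihomogM _ _ (hti i)) leq_addr addKn.
  case: leqP => _; last first.
    by exists (pihomog mdeg d m), 0; rewrite mulr0; split=> //; [apply: hW|apply: subspace0].
  by exists (pihomog mdeg d m), (pihomog mdeg (d - e) w); split=> //; apply: hW.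
have cQ i j : mul_closed ts (Q i j).
  move=> s sts _ [m [w [Wm Nm Ww ->]]]; exists (s * m), (s * w).
  have sts' : s \in t :: ts by rewrite inE sts orbT.
  split; [exact: cW| |exact: cW|by rewrite mulrDr; ring].
  by rewrite mulrCA; apply: cN.
have UQ i j f : add_mul U t W f -> Q i j f.
  move=> [u [w [Uu Ww ->]]]; exists u, w; split=> //; first exact: NW (UN 0%N _ Uu).
  by apply: tiN; apply: UN.
have QW i j f : Q i j f -> W f.
  move=> [m [w [Wm _ Ww ->]]]; apply: subspaceD => //; apply: cW => //; exact: mem_head.
(* The diagonal family settles all [i >= J0] at once; the finitely many [i < J0] are then treated
   one by one. *)
have [J0 HJ0] : stabilizes (fun j => Q j j).
  apply: acc => [j f Qf|j|j|j f|j f]; [|exact: gQ|exact: cQ|exact: UQ|exact: QW].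
  by apply: (@Q_incj _ j) => //; apply: Q_inci (leqnSn j) Qf.
have [J1 HJ1] : exists J, forall i, (i < J0)%N -> forall j f, Q i j f -> Q i J f.
  apply: finite_max_witness => [i J J' JJ' H j f /H|i _]; first exact: Q_incj.
  apply: acc => [j f|j|j|j f|j f]; [exact: Q_incj|exact: gQ|exact: cQ|exact: UQ|exact: QW].
pose J := maxn J0 J1.
have QJ i j f : Q i j f -> Q i J f.
  case: (ltnP i J0) => iJ0 Qf.
    by apply: (Q_incj _ _ _ _ (leq_maxr _ _)); apply: HJ1 Qf.
  apply: (Q_incj _ _ _ _ (leq_maxl _ _)); apply: (Q_inci _ _ _ _ iJ0).
  apply: (HJ0 (maxn i j)); apply: (Q_inci _ _ _ _ (leq_maxl _ _)).
  exact: (Q_incj _ _ _ _ (leq_maxr _ _)) Qf.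
(* Write y = m + t w with t^i m in [N J], up to other degrees. Then t^(i+1) w lies in [N (maxn j J)]
   and w has the smaller degree d - e; for e > d the term t w does not contribute. *)
have rec d : forall j i y, W y -> y \is d.-hom -> N j (t ^+ i * y) -> N J (t ^+ i * y).
  elim/ltn_ind: d => d IH j i y Wy hy Ny.
  have [m [w [Wm Nm Ww yE]]] : Q i J y.
    by apply: (@QJ _ j); exists y, 0; rewrite mulr0 addr0; split=> //; apply: subspace0.
  have [sN hN] := gN J.
  have Nd : N J (t ^+ i * pihomog mdeg d m).
    by have := hN (e * i + d)%N _ Nm; rewrite (pihomogM _ _ (hti i)) leq_addr addKn.
  have : pihomog mdeg d y = y by rewrite pihomog_dE.
  rewrite yE linearD /= (pihomogM _ _ ht) -yE; case: leqP => [ed|_] yE2; last first.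
    by rewrite -yE2 addr0.
  rewrite -yE2 mulrDr; apply: subspaceD => //.
  rewrite mulrA -exprSr; apply: (IH (d - e)%N _ (maxn j J)); first by lia.
  - exact: hW.
  - exact: pihomogP.
  have -> : t ^+ i.+1 * pihomog mdeg (d - e) w = t ^+ i * y - t ^+ i * pihomog mdeg d m.
    by rewrite -{1}yE2 exprSr; ring.
  have [sM _] := gN (maxn j J).
  apply: subspaceB => //; first exact: increasing_le incN (leq_maxl _ _) Ny.
  exact: increasing_le incN (leq_maxr _ _) Nd.
exists J => j f Nf; apply: graded_mem_sum => [|d]; first by case: (gN J).
rewrite -[pihomog _ _ _]mul1r -(expr0 t); apply: (rec d j).
- by apply: hW; apply: NW Nf.
- exact: pihomogP.
by rewrite expr0 mul1r; case: (gN j) => _; apply.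
Qed.

(** Let C = U + tW and let K consist of the f in W with t f in U. Multiplication by [t] gives an
    exact sequence 0 -> K/U -> W/U -> W/U -> W/C -> 0 whose middle map raises degrees by [e]. As [t]
    kills K/U and W/C, induction on the generators applies to both, and the series of W/U satisfies
    a recurrence of step [e]. *)
Lemma hilbert_serre ts W U :
  (forall t, t \in ts -> t != 0 /\ exists2 e, (0 < e)%N & t \is e.-hom) ->
  graded_subspace W -> graded_subspace U -> (forall f, U f -> W f) ->
  mul_closed ts W -> mul_closed ts U -> noetherian ts W U ->
  rational_series (fun d => (hilbert W d)%:R - (hilbert U d)%:R : rat).
Proof.
elim: ts W U => [|t ts IH] W U hts gW gU UW cW cU acc.
  have [sW hW] := gW; have [sU hU] := gU.
  (* Without generators, stationarity of this chain forces [W] and [U] to agree in all large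
     degrees. *)
  pose N j f := W f /\ forall d, (j <= d)%N -> U (pihomog mdeg d f).
  have [|j|j|j f|j f|J HJ] := acc N.
  - by move=> j f [Wf Uf]; split=> // d jd; apply: Uf; apply: ltnW.
  - split; [split|].
    + by split=> [|d _]; rewrite ?linear0; apply: subspace0.
    + move=> a u v [Wu Uu] [Wv Uv]; split; first by case: sW => _; apply.
      by move=> d jd; rewrite linearP /=; case: sU => _; apply; [apply: Uu|apply: Uv].
    + move=> d f [Wf Uf]; split=> [|d' jd']; first exact: hW.
      case: (eqVneq d d') jd' => [<-|ne] jd'; first by rewrite pihomog_id; apply: Uf.
      by rewrite (pihomog_ne0 ne (pihomogP _ _ _)); apply: subspace0.
  - by [].
  - by move=> Uf; split=> [|d _]; [apply: UW|apply: hU].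
  - by case.
  apply: (@rational_series_finite _ J) => d Jd; apply/eqP; rewrite subr_eq0.
  rewrite (@eq_hilbert _ _ W U d) // => f; split=> [[Wf hf]|[Uf hf]]; last first.
    by split=> //; apply: UW.
  split=> //; have [|_ UJ] := HJ d.+1 f.
    by split=> // d' dd'; rewrite (pihomog_ne0 _ hf) ?(ltn_eqF dd') //; apply: subspace0.
  by rewrite -(pihomog_dE hf); apply: UJ.
have [t0 [e e0 ht]] := hts t (mem_head _ _).
have hts' s : s \in ts -> s != 0 /\ exists2 e, (0 < e)%N & s \is e.-hom.
  by move=> sts; apply: hts; rewrite inE sts orbT.
have [sW hW] := gW; have [sU hU] := gU.
have tW f : W f -> W (t * f) by apply: cW; apply: mem_head.
have cW' : mul_closed ts W by move=> s sts; apply: cW; rewrite inE sts orbT.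
have cU' : mul_closed ts U by move=> s sts; apply: cU; rewrite inE sts orbT.
pose K f := W f /\ U (t * f).
have gK : graded_subspace K.
  split; [split|].
  - by split; rewrite ?mulr0; apply: subspace0.
  - move=> a u v [Wu Uu] [Wv Uv]; split; first by case: sW => _; apply.
    by rewrite mulrDr -scalerAr; case: sU => _; apply.
  move=> d f [Wf Uf]; split; first exact: hW.
  by have := hU (e + d)%N _ Uf; rewrite (pihomogM _ _ ht) leq_addr addKn.
pose C := add_mul U t W.
have gC : graded_subspace C by apply: graded_add_mul ht gU gW.
have ratC : rational_series (fun d => (hilbert W d)%:R - (hilbert C d)%:R : rat).
  apply: IH => //.
  - by move=> _ [u [w [Uu Ww ->]]]; apply: subspaceD => //; [apply: UW|apply: tW].
  - move=> s sts _ [u [w [Uu Ww ->]]]; exists (s * u), (s * w).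
    by split; [apply: cU'|apply: cW'|rewrite mulrDr; ring].
  move=> N incN gN cN CN NW; apply: acc => //.
    move=> j s; rewrite inE => /predU1P[-> f /NW Wf|sts]; last exact: cN.
    by apply: CN; exists 0, f; rewrite add0r; split=> //; apply: subspace0.
  move=> j f Uf; apply: CN; exists f, 0; rewrite mulr0 addr0; split=> //; exact: subspace0.
have ratK : rational_series (fun d => (hilbert K d)%:R - (hilbert U d)%:R : rat).
  apply: IH => //.
  - by move=> f Uf; split; [apply: UW|apply: cU => //; apply: mem_head].
  - move=> s sts f [Wf Uf]; split; first exact: cW'.
    by rewrite mulrCA; apply: cU'.
  move=> N incN gN cN UN NK; apply: acc => //.
    move=> j s; rewrite inE => /predU1P[-> f /NK [_ Uf]|sts]; last exact: cN.
    exact: UN.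
  by move=> j f /NK [].
pose a d := (hilbert W d)%:R - (hilbert U d)%:R : rat.
apply: (rational_series_recurrence e0 (c := fun d => ((hilbert W d)%:R - (hilbert C d)%:R)
    - shift_series e (fun d => (hilbert K d)%:R - (hilbert U d)%:R) d)); last first.
  by apply: rational_seriesB => //; apply: rational_series_shift.
move=> d; rewrite /shift_series; case: leqP => ed; last first.
  rewrite subr0 addr0; congr (_ - _%:R); apply: eq_hilbert => //; first by case: gC.
  move=> f; split=> [[Uf hf]|[[u [w [Uu Ww fE]]] hf]]; split=> //.
    by exists f, 0; rewrite mulr0 addr0; split=> //; apply: subspace0.
  rewrite -(pihomog_dE hf) fE linearD /= (pihomogM _ _ ht) leqNgt ed addr0.
  exact: hU.
have -> : d = (d - e + e)%N by rewrite subnK.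
set d' := (d - e)%N; rewrite addnK.
pose tWp f := exists2 g, W g & f = t * g.
have stW : is_subspace tWp.
  split; first by exists 0; rewrite ?mulr0 //; apply: subspace0.
  move=> x _ _ [u Wu ->] [v Wv ->]; exists (x *: u + v); first by case: sW => _; apply.
  by rewrite mulrDr scalerAr.
pose UtW f := exists2 g, K g & f = t * g.
have sUtW : is_subspace UtW.
  have [sK _] := gK; split; first by exists 0; rewrite ?mulr0 //; apply: subspace0.
  move=> x _ _ [u Ku ->] [v Kv ->]; exists (x *: u + v); first by case: sK => _; apply.
  by rewrite mulrDr scalerAr.
(* The dimension formula for C = U + tW, where U cap tW = tK. *)
have E : (hilbert C (d' + e) + hilbert UtW (d' + e) =
          hilbert U (d' + e) + hilbert tWp (d' + e))%N.
  apply: (hilbert_sum_cap sU stW (proj1 gC) sUtW) => f.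
    split=> [[[u [w [Uu Ww fE]]] hf]|[u [_ [[Uu hu] [[w Ww ->] hw] ->]]]].
      exists (pihomog mdeg (d' + e) u), (t * pihomog mdeg d' w); split.
      + by split; [apply: hU|apply: pihomogP].
      + split; first by exists (pihomog mdeg d' w) => //; apply: hW.
        by rewrite addnC; apply: dhomogM => //; apply: pihomogP.
      by rewrite -(pihomog_dE hf) fE linearD /= (pihomogM _ _ ht) leq_addl addnK.
    by split; [exists u, w|apply: rpredD].
  split=> [[[g [Wg Ug] ->] hf]|[[Uf hf] [[g Wg fE] _]]].
    by do !split=> //; exists g.
  by split=> //; exists g => //; split=> //; rewrite -fE.
move: E; rewrite (hilbert_mul d' t0 ht gW stW) // (hilbert_mul d' t0 ht gK sUtW) //.
move=> /(congr1 (fun m : nat => m%:R : rat)); rewrite !natrD => E.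
have -> : (hilbert C (d' + e))%:R = (hilbert U (d' + e))%:R + (hilbert W d')%:R
   - (hilbert K d')%:R :> rat by rewrite -E addrK.
ring.
Qed.
End Graded.

(** * Modules over the symmetric polynomials *)

Section SymmetricNoetherian.
Variables (k : fieldType) (n : nat).
Local Notation V := {mpoly k[n]}.
Implicit Types (W U : V -> Prop) (f g t : V).

(** U + t_1 W + ... + t_r W, accumulated in the last argument because [noetherian_cons] passes from
    [U] to [add_mul U t W]. *)
Fixpoint add_ideal (ts : seq V) W U : V -> Prop :=
  if ts is t :: ts' then add_ideal ts' W (add_mul U t W) else U.

(** Once all generators are peeled off by [noetherian_cons], the remaining quotient vanishes in
    degrees at least [D]; in each lower degree the dimension stops the chain. *)
Lemma noetherian_add_ideal ts W U D :
  (forall t, t \in ts -> exists2 e, (0 < e)%N & t \is e.-hom) ->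
  graded_subspace W -> graded_subspace U -> mul_closed ts W ->
  (forall d f, (D <= d)%N -> homog_part W d f -> add_ideal ts W U f) ->
  noetherian ts W U.
Proof.
move=> hts gW; elim: ts hts U => [|t ts IH] hts U gU cW large.
  move=> N incN gN _ UN NW.
  have [J HJ] : exists J, forall d, (d < D)%N -> forall j f, homog_part (N j) d f -> N J f.
    apply: finite_max_witness => [d J J' JJ' H j f /H|d _].
      exact: increasing_le incN JJ'.
    by apply: stabilizes_in_degree => // j; case: (gN j).
  exists J => j f Nf; apply: graded_mem_sum => [|d]; first by case: (gN J).
  have [sN hN] := gN j.
  have Nd : homog_part (N j) d (pihomog mdeg d f) by split; [apply: hN|apply: pihomogP].
  case: (ltnP d D) => dD; first exact: HJ Nd.
  by apply: UN; apply: (large d) => //; case: Nd => Nd hd; split=> //; apply: NW Nd.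
have [e e0 ht] := hts t (mem_head _ _).
apply: (noetherian_cons e0 ht gW cW); apply: IH => //.
- by move=> s sts; apply: hts; rewrite inE sts orbT.
- exact: graded_add_mul ht gU gW.
by move=> s sts; apply: cW; rewrite inE sts orbT.
Qed.

Local Notation whole := (fun _ : V => True).

Lemma add_ideal_subspace ts U : is_subspace U -> is_subspace (add_ideal ts whole U).
Proof.
elim: ts U => [|t ts IH] U sU //=; apply: IH; split.
  by exists 0, 0; rewrite mulr0 addr0; split=> //; apply: subspace0.
move=> a _ _ [u [w [Uu _ ->]]] [u' [w' [Uu' _ ->]]].
exists (a *: u + u'), (a *: w + w'); split=> //; first by case: sU => _; apply.
by rewrite mulrDr scalerDr scalerAr addrACA.
Qed.

Lemma add_ideal_base ts U f : U f -> add_ideal ts whole U f.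
Proof.
elim: ts U => [|t ts IH] U Uf //=; apply: IH.
by exists f, 0; rewrite mulr0 addr0.
Qed.

Lemma add_ideal_mem ts U t f : is_subspace U -> t \in ts -> add_ideal ts whole U (t * f).
Proof.
elim: ts U => [|s ts IH] U sU //=; rewrite inE => /predU1P[->|tts].
  apply: add_ideal_base; exists 0, f; rewrite add0r; split=> //; exact: subspace0.
apply: IH => //; exact: (@add_ideal_subspace [:: s]).
Qed.

Definition elementary_symmetric : seq V := [seq mesym n k j.+1 | j <- iota 0 n].

Lemma elementary_symmetricP t : t \in elementary_symmetric ->
  [/\ t != 0, t \is symmetric & exists2 e, (0 < e)%N & t \is e.-hom].
Proof.
move=> /mapP[j]; rewrite mem_iota add0n => /andP[_ jn] ->; split.
- exact: mesym_neq0.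
- exact: mesym_sym.
by exists j.+1 => //; apply: dhomog_mesym.
Qed.

Lemma mesym_eval_var j : (mesym n V j).@[tnth [tuple 'X_i | i < n]] = mesym n k j.
Proof.
rewrite /mesym raddf_sum /=; apply: eq_bigr => h _; rewrite rmorph_prod /=.
by apply: eq_bigr => i _; rewrite mevalXU tnth_mktuple.
Qed.

(** x_i is a root of prod_j (X - x_j), a monic polynomial of degree n whose lower coefficients are,
    up to sign, elementary symmetric polynomials. *)
Lemma var_power_in_ideal i f : add_ideal elementary_symmetric whole (fun f => f = 0) ('X_i ^+ n * f).
Proof.
set I := add_ideal _ _ _; have sI : is_subspace I.
  exact/add_ideal_subspace/zero_subspace.
pose cs : n.-tuple V := [tuple 'X_i | i < n].
pose p := \prod_(c <- cs) ('X - c%:P).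
have szp : size p = n.+1 by rewrite size_prod_XsubC size_tuple.
have mp : p \is monic by apply: monic_prod_XsubC.
have : p.[ 'X_i ] = 0.
  apply/rootP; rewrite root_prod_XsubC; apply/tnthP; exists i; by rewrite tnth_mktuple.
rewrite horner_coef szp big_ord_recr /=.
have -> : p`_n = 1 by rewrite -[RHS](monicP mp) lead_coefE szp.
rewrite mul1r addrC => /eqP; rewrite addr_eq0 => /eqP ->.
rewrite mulNr; apply: subspaceN => //; rewrite mulr_suml; apply: subspace_sum => // j _ _.
have -> : p`_j = (-1) ^+ (n - j) * mesym n k (n - j).
  have lt : (n - j < n.+1)%N by rewrite ltnS leq_subr.
  have := mroots_coeff cs (Ordinal lt); rewrite /= subKn ?(ltnW (ltn_ord j)) // => ->.
  by rewrite mesym_eval_var.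
rewrite [_ * mesym _ _ _]mulrC -!mulrA; apply: add_ideal_mem; first exact: zero_subspace.
apply/mapP; exists (n - j).-1; last by rewrite prednK // subn_gt0.
by rewrite mem_iota add0n /=; have := ltn_ord j; lia.
Qed.

Lemma graded_zero : graded_subspace (fun f : V => f = 0).
Proof. by split=> [|d _ ->]; [apply: zero_subspace|rewrite linear0]. Qed.

(* k[x] is integral over the symmetric polynomials.                           *)
Lemma noetherian_symmetric : noetherian elementary_symmetric whole (fun f => f = 0).
Proof.
(* A monomial of degree above n^2 has some exponent at least n. *)
apply: (@noetherian_add_ideal _ _ _ (n * n).+1) => //.
- by move=> t /elementary_symmetricP[].
- exact: graded_zero.
move=> d f Dd [_ hf]; rewrite [f]mpolyE; apply: subspace_sum.
  exact/add_ideal_subspace/zero_subspace.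
move=> m mf _; apply: subspaceZ; first exact/add_ideal_subspace/zero_subspace.
have [i ni] : exists i, (n <= m i)%N.
  apply/existsP; rewrite -[X in is_true X]negbK; apply/negP; rewrite negb_exists => /forallP H.
  have : (mdeg m <= \sum_(i < n) n)%N.
    by rewrite mdegE; apply: leq_sum => i _; apply: ltnW; rewrite ltnNge.
  rewrite sum_nat_const card_ord leqNgt (dhomog_mf hf mf).
  by move/negP; apply.
have -> : 'X_[m] = 'X_i ^+ n * 'X_[(m - U_(i) *+ n)] :> V.
  rewrite mpolyXn -mpolyXD addmC submK //; apply/mnm_lepP => j.
  by rewrite mulmnE mnm1E; case: eqP => [<-|_]; rewrite ?mul1n ?mul0n.
exact: var_power_in_ideal.
Qed.

Lemma hilbert_symmetric_module W : graded_subspace W -> mul_closed elementary_symmetric W ->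
  rational_series (fun d => (hilbert W d)%:R : rat).
Proof.
move=> gW cW.
have rat : rational_series
    (fun d => (hilbert W d)%:R - (hilbert (fun f : V => f = 0) d)%:R : rat).
  apply: (@hilbert_serre _ _ elementary_symmetric) => //.
  - by move=> t /elementary_symmetricP[].
  - exact: graded_zero.
  - by move=> _ ->; apply: subspace0; case: gW.
  - by move=> t _ _ ->; rewrite mulr0.
  move=> N incN gN cN zN _; exact: noetherian_symmetric.
apply: eq_rational_series rat => d.
by rewrite [X in _ - X%:R]hilbert0 ?subr0 // => [|f []//]; apply: zero_subspace.
Qed.

End SymmetricNoetherian.

(** * Twisted Witt operators and restriction to hyperplanes *)

Section AlgebraInduction.
Variables (k : fieldType) (n : nat).

Lemma mpoly_alg_ind (P : {mpoly k[n]} -> Prop) :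
  (forall c, P c%:MP) -> (forall i, P 'X_i) ->
  (forall f g, P f -> P g -> P (f + g)) -> (forall f g, P f -> P g -> P (f * g)) ->
  forall f, P f.
Proof.
move=> PC PX PD PM; elim/mpolyind => [|c m p _ _ IH]; first by rewrite -mpolyC0.
apply: (PD) => //; rewrite -mul_mpolyC; apply: (PM) => //; rewrite mpolyXE_id.
elim/big_ind: _ => [|f g|i _]; [by rewrite -mpolyC1|exact: PM|].
by elim: (m i) => [|e IHe]; rewrite ?expr0 -?mpolyC1 // exprS; apply: PM.
Qed.

End AlgebraInduction.

Section Operators.
Variables (k : fieldType) (n : nat).
Local Notation V := {mpoly k[n]}.
Implicit Types (S : V -> Prop) (f g : V) (u w : 'I_n -> nat).

Definition euler (i : 'I_n) f : V := 'X_i * f^`M(i).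

Lemma euler_linear i : linear (euler i).
Proof. by move=> a f g; rewrite /euler linearP /= mulrDr scalerAr. Qed.
HB.instance Definition _ i := GRing.isLinear.Build k V V _ (euler i) (euler_linear i).

Lemma eulerM i f g : euler i (f * g) = euler i f * g + f * euler i g.
Proof. by rewrite /euler mderivM; ring. Qed.

Lemma eulerX i m : euler i 'X_[m] = (m i)%:R *: 'X_[m] :> V.
Proof.
rewrite /euler mderivX -scalerAr -mpolyXD; case: (posnP (m i)) => [->|mi].
  by rewrite !scale0r.
by rewrite addmC submK // lep1mP -lt0n.
Qed.

Lemma eulerXU i j : euler i 'X_j = (i == j)%:R *: 'X_j :> V.
Proof. by rewrite eulerX mnm1E; congr (_%:R *: _); rewrite eq_sym. Qed.

Lemma eulerC i c : euler i c%:MP = 0.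
Proof. by rewrite /euler mderivC mulr0. Qed.

(* [witt m] is the vector field x^(m+1) d/dx acting on all the variables.     *)
Definition witt (m : nat) f : V := \sum_i 'X_i ^+ m * euler i f.

Lemma witt_linear m : linear (witt m).
Proof.
move=> a f g; rewrite /witt scaler_sumr -big_split; apply: eq_bigr => i _ /=.
by rewrite (linearP (euler i)) /= mulrDr -scalerAr.
Qed.
HB.instance Definition _ m := GRing.isLinear.Build k V V _ (witt m) (witt_linear m).

Lemma wittM m f g : witt m (f * g) = witt m f * g + f * witt m g.
Proof.
rewrite /witt mulr_suml mulr_sumr -big_split; apply: eq_bigr => i _ /=.
by rewrite eulerM; ring.
Qed.

Lemma witt_exp m f s : witt m (f ^+ s) = s%:R *: (f ^+ s.-1 * witt m f).
Proof.
elim: s => [|s IH].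
  rewrite expr0 scale0r /witt big1 // => i _.
  by rewrite -mpolyC1 eulerC mulr0.
rewrite exprS wittM IH /=; case: s {IH} => [|s].
  by rewrite scale0r expr0 mulr0 addr0 scale1r mulrC.
rewrite -scalerAr mulrA -exprS [in RHS]mulrS scalerDl scale1r.
by congr (_ + _); rewrite mulrC.
Qed.

(* The twisting parameters come from restricting jets to the diagonals: near  *)
(* x_i = x_j, a multiple of (x_i - x_j)^s transforms with the factor p'^s.    *)
Definition twist u w m : V := \sum_i (u i + w i * m)%:R *: 'X_i ^+ m.

Definition twisted_witt u w m f : V := witt m f + twist u w m * f.

Lemma twisted_witt_linear u w m : linear (twisted_witt u w m).
Proof. by move=> a f g; rewrite /twisted_witt linearP /= mulrDr scalerDr scalerAr addrACA. Qed.
HB.instance Definition _ u w m :=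
  GRing.isLinear.Build k V V _ (twisted_witt u w m) (twisted_witt_linear u w m).

Definition witt_closed u w S :=
  graded_subspace S /\ forall m f, (0 < m)%N -> S f -> S (twisted_witt u w m f).

Lemma twisted_wittX u w m a : twisted_witt u w m 'X_[a] =
  \sum_i (a i + u i + w i * m)%:R *: ('X_i ^+ m * 'X_[a]).
Proof.
rewrite /twisted_witt /witt /twist mulr_suml -big_split; apply: eq_bigr => i _ /=.
by rewrite eulerX -scalerAr -scalerAl -scalerDl -natrD addnA.
Qed.

End Operators.

(** * Restriction to a hyperplane *)

Section Restriction.
Variables (k : fieldType) (n : nat) (i j : 'I_n).
Local Notation V := {mpoly k[n]}.
Local Notation V' := {mpoly k[n.-1]}.

(* The case i = j encodes the coordinate hyperplane x_i = 0.                  *)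
Definition linear_form : V := if i == j then 'X_i else 'X_i - 'X_j.

Definition restrict_var (a : 'I_n) : V' :=
  if unlift i a is Some l then 'X_l else if unlift i j is Some l then 'X_l else 0.

Definition restrict : V -> V' := comp_mpoly [tuple restrict_var a | a < n].

HB.instance Definition _ := GRing.RMorphism.copy restrict (comp_mpoly _).
HB.instance Definition _ := GRing.Linear.copy restrict (comp_mpoly _).

Lemma restrictM f g : restrict (f * g) = restrict f * restrict g.
Proof. exact: rmorphM. Qed.

Lemma restrictD f g : restrict (f + g) = restrict f + restrict g.
Proof. exact: rmorphD. Qed.

Lemma restrictXn f m : restrict (f ^+ m) = restrict f ^+ m.
Proof. exact: rmorphXn. Qed.

Lemma restrictZ a f : restrict (a *: f) = a *: restrict f.
Proof. exact: linearZ. Qed.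

Lemma restrictXU a : restrict 'X_a = restrict_var a.
Proof. by rewrite /restrict comp_mpolyXU -tnth_nth tnth_mktuple. Qed.

Lemma restrictC c : restrict c%:MP = c%:MP.
Proof. exact: comp_mpolyC. Qed.

Lemma restrict_lift l : restrict 'X_(lift i l) = 'X_l.
Proof. by rewrite restrictXU /restrict_var liftK. Qed.

Lemma restrict_var_self : restrict 'X_i = if unlift i j is Some l then 'X_l else 0.
Proof. by rewrite restrictXU /restrict_var unlift_none. Qed.

Lemma restrict_linear_form : restrict linear_form = 0.
Proof.
rewrite /linear_form; case: eqP => [ij|ij].
  by rewrite restrict_var_self -ij unlift_none.
rewrite rmorphB /= restrict_var_self restrictXU /restrict_var.
case: unliftP => [l|/esym //]; by rewrite subrr.
Qed.

Definition extend : V' -> V := comp_mpoly [tuple 'X_(lift i l) | l < n.-1].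

HB.instance Definition _ := GRing.RMorphism.copy extend (comp_mpoly _).

Lemma extendXU l : extend 'X_l = 'X_(lift i l).
Proof. by rewrite /extend comp_mpolyXU -tnth_nth tnth_mktuple. Qed.

(** Modulo [linear_form], [extend] after [restrict] is an algebra map that fixes every variable. *)
Lemma extend_restrict f : exists g, f - extend (restrict f) = linear_form * g.
Proof.
elim/mpoly_alg_ind: f => [c|a|f g [f' Ef] [g' Eg]|f g [f' Ef] [g' Eg]].
- by exists 0; rewrite restrictC /extend comp_mpolyC subrr mulr0.
- rewrite restrictXU /restrict_var; case: unliftP => [l ->|->].
    by exists 0; rewrite extendXU subrr mulr0.
  exists 1; rewrite mulr1 /linear_form; case: unliftP => [l ->|<-].
    by rewrite extendXU (negbTE (neq_lift _ _)).
  by rewrite /extend comp_mpoly0 subr0 eqxx.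
- exists (f' + g'); rewrite mulrDr -Ef -Eg rmorphD /= /extend comp_mpolyD; ring.
exists (f' * g + extend (restrict f) * g').
rewrite mulrDr mulrA -Ef mulrCA -Eg rmorphM /= /extend rmorphM /=; ring.
Qed.

Lemma restrict_eq0 f : restrict f = 0 -> exists g, f = linear_form * g.
Proof.
by move=> f0; have [g E] := extend_restrict f; exists g; rewrite -E f0 /extend comp_mpoly0 subr0.
Qed.

(** Chain rule: the variable that replaces x_i collects the derivative along x_i as well. *)
Lemma euler_restrict l f :
  euler l (restrict f) = restrict (euler (lift i l) f) +
    (unlift i j == Some l)%:R *: restrict (euler i f).
Proof.
elim/mpoly_alg_ind: f => [c|a|f g Ef Eg|f g Ef Eg].
- by rewrite restrictC !eulerC rmorph0 scaler0 addr0.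
- rewrite !eulerXU !linearZ /= restrictXU /restrict_var.
  case: unliftP => [l' ->|->].
    by rewrite (negbTE (neq_lift _ _)) scale0r addr0 eulerXU (inj_eq (@lift_inj _ _)).
  rewrite eqxx scale1r eq_sym (negbTE (neq_lift _ _)) scale0r add0r.
  case: (unlift i j) => [l'|]; last by rewrite linear0 scaler0.
  by rewrite eulerXU (inj_eq Some_inj) [l' == l]eq_sym.
- by rewrite !linearD /= Ef Eg addrACA.
rewrite rmorphM /= !eulerM Ef Eg !rmorphD !rmorphM /= scalerDr.
by rewrite mulrDl mulrDr -!scalerAl -!scalerAr addrACA.
Qed.

Lemma sum_restrict_var_self m (Z : V') : (0 < m)%N ->
  \sum_l (unlift i j == Some l)%:R *: ('X_l ^+ m * Z) = restrict 'X_i ^+ m * Z.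
Proof.
move=> m0; rewrite restrict_var_self; case: (unlift i j) => [l|]; last first.
  by rewrite expr0n (gtn_eqF m0) mul0r big1 // => l _; rewrite scale0r.
rewrite (bigD1 l) //= eqxx scale1r big1 ?addr0 // => l' ne.
by rewrite (inj_eq Some_inj) eq_sym (negbTE ne) scale0r.
Qed.

(** The vector field is tangent to the hyperplane. *)
Lemma restrict_witt m f : (0 < m)%N -> restrict (witt m f) = witt m (restrict f).
Proof.
move=> m0; rewrite /witt rmorph_sum /= (bigD1_ord i) //=.
rewrite restrictM restrictXn -sum_restrict_var_self // addrC -big_split; apply: eq_bigr => l _.
by rewrite restrictM restrictXn restrict_lift euler_restrict mulrDr -scalerAr.
Qed.

(** [witt m] sends l^s to s l^s times a cofactor which restricts to (m+1) x_j^m when i <> j. Since s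
    (m+1) = s + s m, both weights of x_j grow by [s], besides inheriting those of x_i. For i = j
    everything attached to x_i restricts to 0. *)
Definition restrict_weight (s : nat) (u : 'I_n -> nat) (l : 'I_n.-1) : nat :=
  (u (lift i l) + (unlift i j == Some l) * (u i + s))%N.

Lemma restrict_twist s u w m : (0 < m)%N ->
  restrict (twist _ u w m) + s%:R *: (m.+1%:R *: restrict 'X_i ^+ m) =
  twist _ (restrict_weight s u) (restrict_weight s w) m.
Proof.
move=> m0; rewrite /twist rmorph_sum /= (bigD1_ord i) //= restrictZ restrictXn.
rewrite scalerA addrAC -scalerDl -[_ ^+ m]mulr1 -sum_restrict_var_self //.
rewrite scaler_sumr -big_split; apply: eq_bigr => l _ /=.
rewrite restrictZ restrictXn restrict_lift mulr1 scalerA -scalerDl; congr (_ *: _).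
by rewrite -natrM -natrD -natrM -natrD /restrict_weight; congr (_%:R); lia.
Qed.

Lemma witt_linear_form m : exists2 h, witt m linear_form = linear_form * h &
  (0 < m)%N -> restrict h = m.+1%:R *: restrict 'X_i ^+ m.
Proof.
have wX a : witt m 'X_a = 'X_a ^+ m.+1 :> V.
  rewrite /witt (bigD1 a) //= eulerXU eqxx scale1r -exprSr big1 ?addr0 // => b ne.
  by rewrite eulerXU (negbTE ne) scale0r mulr0.
have [ij|ij] := eqVneq i j.
  exists ('X_i ^+ m); first by rewrite /linear_form ij eqxx wX exprS.
  move=> m0; rewrite restrictXn restrict_var_self -ij unlift_none.
  by rewrite expr0n (gtn_eqF m0) scaler0.
rewrite /linear_form (negbTE ij).
exists (\sum_(b < m.+1) 'X_i ^+ (m.+1.-1 - b) * 'X_j ^+ b).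
  by rewrite linearB /= !wX subrXX.
move=> _; rewrite rmorph_sum /=.
have rij : restrict 'X_i = restrict 'X_j.
  apply/eqP; rewrite -subr_eq0 -rmorphB; apply/eqP; have := restrict_linear_form.
  by rewrite /linear_form (negbTE ij).
under eq_bigr => b _.
  rewrite restrictM !restrictXn rij -exprD subnK; last by rewrite -ltnS.
  over.
rewrite rij /=.
by rewrite sumr_const card_ord scaler_nat.
Qed.

Lemma twisted_witt_restrict s u w m f : (0 < m)%N ->
  exists2 f', twisted_witt u w m (linear_form ^+ s * f) = linear_form ^+ s * f' &
    restrict f' =
    twisted_witt (restrict_weight s u) (restrict_weight s w) m (restrict f).
Proof.
move=> m0; have [h wl rh] := witt_linear_form m.
exists (witt m f + twist _ u w m * f + s%:R *: (h * f)).
  have -> : twisted_witt u w m (linear_form ^+ s * f) = linear_form ^+ s * (witt m f) +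
      linear_form ^+ s * (twist _ u w m * f) + witt m (linear_form ^+ s) * f.
    by rewrite /twisted_witt wittM [RHS]addrC addrA; congr (_ + _); apply: mulrCA.
  rewrite !mulrDr; congr (_ + _); rewrite witt_exp wl -scalerAl -scalerAr.
  case: s => [|s]; first by rewrite !scale0r.
  congr (_ *: _); by rewrite /= mulrA -exprSr mulrA.
rewrite !restrictD restrictZ !restrictM restrict_witt // rh //.
by rewrite /twisted_witt -restrict_twist // mulrDl -!scalerAl addrA.
Qed.

Lemma linear_form_homog : linear_form \is 1.-hom.
Proof.
have hX a : ('X_a : V) \is 1.-hom by rewrite dhomogX; apply/eqP/mdeg1.
by rewrite /linear_form; case: ifP => _ //; apply: rpredB.
Qed.

Lemma linear_form_neq0 : linear_form != 0.
Proof.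
apply/eqP => /(congr1 (mcoeff U_(i)%MM)); rewrite mcoeff0 /linear_form.
case: (eqVneq i j) => [_|ij]; rewrite ?mcoeffB !mcoeffXU eqxx.
  by apply/eqP; apply: oner_neq0.
by rewrite eq_sym (negbTE ij) subr0; apply/eqP; apply: oner_neq0.
Qed.

Lemma restrict_var_homog a : restrict_var a \is 1.-hom.
Proof.
have hX l : ('X_l : V') \is 1.-hom by rewrite dhomogX; apply/eqP/mdeg1.
rewrite /restrict_var; case: (unlift i a) => [l //|].
by case: (unlift i j) => [l //|]; apply: rpred0.
Qed.

Lemma pihomog_restrict d f : pihomog mdeg d (restrict f) = restrict (pihomog mdeg d f).
Proof.
elim/mpolyind: f => [|c m p _ _ IH]; first by rewrite !rmorph0 !linear0.
rewrite !linearD !linearZ /= IH pihomogX; congr (_ *: _ + _).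
have hX : restrict 'X_[m] \is (mdeg m).-hom.
  rewrite /restrict comp_mpolyX mdegE; elim/big_rec2: _ => [|a d' f _ hf].
    exact: dhomog1.
  apply: dhomogM => //; rewrite tnth_mktuple.
  by have := dhomogMn (m a) (restrict_var_homog a); rewrite mul1n.
case: eqP => [<-|/eqP ne]; first by rewrite pihomog_dE.
by rewrite rmorph0 (pihomog_ne0 ne hX).
Qed.

End Restriction.

(** * Jets along hyperplanes *)

Section Divisibility.
Variables (k : fieldType) (n : nat).
Local Notation V := {mpoly k[n]}.
Implicit Types (S : V -> Prop) (f g p : V).

Definition divides p f := exists g, f = p * g.

Lemma divides_subspace p : is_subspace (divides p).
Proof.
split=> [|a _ _ [g ->] [h ->]]; first by exists 0; rewrite mulr0.
by exists (a *: g + h); rewrite mulrDr scalerAr.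
Qed.

Definition jet_filtration S (fs : seq ('I_n * 'I_n)) e f :=
  S f /\ forall q, q \in fs -> divides (linear_form k q.1 q.2 ^+ e) f.

End Divisibility.

Definition chain_condition (k : fieldType) (n : nat) (u w : 'I_n -> nat) :=
  forall S : nat -> {mpoly k[n]} -> Prop,
  increasing S -> (forall t, witt_closed u w (S t)) -> stabilizes S.

Definition rational_condition (k : fieldType) (n : nat) (u w : 'I_n -> nat) :=
  forall S : {mpoly k[n]} -> Prop, witt_closed u w S ->
  rational_series (fun d => (hilbert S d)%:R : rat).

Section Jets.
Variables (k : fieldType) (n : nat) (i j : 'I_n) (u w : 'I_n -> nat).
Local Notation V := {mpoly k[n]}.
Local Notation V' := {mpoly k[n.-1]}.
Local Notation l := (linear_form k i j).
Implicit Types (S : V -> Prop) (f g p : V).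

Lemma linear_form_exp_homog s : l ^+ s \is s.-hom.
Proof. by have := dhomogMn s (linear_form_homog k i j); rewrite mul1n. Qed.

Lemma linear_form_exp_neq0 s : l ^+ s != 0.
Proof. by rewrite expf_neq0 // linear_form_neq0. Qed.

(** Leading coefficients along l = 0, a model of S cap (l^s) modulo S cap (l^(s+1)). *)
Definition jets S s (f' : V') := exists2 g, S (l ^+ s * g) & f' = restrict i j g.

Lemma graded_colon S s : graded_subspace S -> graded_subspace (fun g => S (l ^+ s * g)).
Proof.
move=> [sS gS]; split; [split|].
- by rewrite mulr0; apply: subspace0.
- by move=> a f g Sf Sg; rewrite mulrDr -scalerAr; case: sS => _; apply.
move=> d f Sf; have := gS (s + d)%N _ Sf.
by rewrite (pihomogM _ _ (linear_form_exp_homog s)) leq_addr addKn.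
Qed.

Lemma jets_closed S s : witt_closed u w S ->
  witt_closed (restrict_weight i j s u) (restrict_weight i j s w) (jets S s).
Proof.
move=> [gS cS]; have [sQ gQ] := graded_colon s gS; split.
  split; [split|].
  - by exists 0; [apply: subspace0 sQ|rewrite rmorph0].
  - move=> a _ _ [f Sf ->] [g Sg ->]; exists (a *: f + g); first by case: sQ => _; apply.
    by rewrite restrictD restrictZ.
  move=> d _ [g Sg ->]; exists (pihomog mdeg d g); last exact: pihomog_restrict.
  exact: gQ.
move=> m _ m0 [g Sg ->].
have [g' E <-] := twisted_witt_restrict i j s u w g m0.
by exists g' => //; rewrite -E; apply: cS.
Qed.

Lemma cap_power_closed S e : witt_closed u w S ->
  witt_closed u w (fun f => S f /\ divides (l ^+ e) f).
Proof.
move=> [[sS gS] cS]; split; [split; [split|]|].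
- by split; apply: subspace0 => //; apply: divides_subspace.
- move=> a f g [Sf df] [Sg dg]; split; first by case: sS => _; apply.
  by case: (divides_subspace (l ^+ e)) => _; apply.
- move=> d f [Sf [g fE]]; split; first exact: gS.
  rewrite fE (pihomogM _ _ (linear_form_exp_homog e)); case: ifP => _.
    by exists (pihomog mdeg (d - e) g).
  by exists 0; rewrite mulr0.
move=> m f m0 [Sf [g fE]]; split; first exact: cS.
by have [g' E _] := twisted_witt_restrict i j e u w g m0; exists g'; rewrite fE E.
Qed.

Hypothesis IHchain : forall u' w', @chain_condition k n.-1 u' w'.
Hypothesis IHrat : forall u' w', @rational_condition k n.-1 u' w'.

(** Descend from [e] to 0. Modulo l^(s+1), an element of S_t cap (l^s) agrees with one of a fixed
    member of the chain, because the jets stabilize; the difference belongs to the chain for s+1,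
    which is already stationary. *)
Lemma stabilizes_of_cap (S : nat -> V -> Prop) e : increasing S ->
  (forall t, witt_closed u w (S t)) ->
  stabilizes (fun t f => S t f /\ divides (l ^+ e) f) -> stabilizes S.
Proof.
move=> incS cS; elim: e => [|s IH].
  by move=> [J HJ]; exists J => t f Sf; apply: (HJ t f _).1; split=> //;
    exists f; rewrite expr0 mul1r.
move=> [J1 HJ1]; apply: IH.
have [|t|J2 HJ2] := @IHchain (restrict_weight i j s u) (restrict_weight i j s w)
  (fun t => jets (S t) s).
- by move=> t f' [g Sg ->]; exists g => //; apply: incS.
- exact: jets_closed.
exists (maxn J1 J2) => t f [Sf [g fE]]; split; last by exists g.
have [g' Sg' E] : jets (S J2) s (restrict i j g).
  by apply: (HJ2 t); exists g; rewrite -?fE.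
have [h hE] : exists h, g - g' = l * h by apply: restrict_eq0; rewrite rmorphB /= E subrr.
pose M := maxn t J2.
have [[sM _] _] := cS M; have [[sJ _] _] := cS (maxn J1 J2).
have ft : l ^+ s * g' + l ^+ s.+1 * h = f.
  by rewrite exprSr -mulrA -hE fE mulrBr addrC subrK.
have [SJ _] : S J1 (l ^+ s.+1 * h) /\ divides (l ^+ s.+1) (l ^+ s.+1 * h).
  apply: (HJ1 M); split; last by exists h.
  have -> : l ^+ s.+1 * h = f - l ^+ s * g' by rewrite -ft addrC addKr.
  apply: subspaceB => //; first exact: increasing_le incS (leq_maxl _ _) Sf.
  exact: increasing_le incS (leq_maxr _ _) Sg'.
rewrite -ft; apply: subspaceD => //; first exact: increasing_le incS (leq_maxr _ _) Sg'.
exact: increasing_le incS (leq_maxl _ _) SJ.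
Qed.

(** Rank-nullity for restriction on the g with l^s g in S; multiplication by l^s accounts for the
    shift. *)
Lemma hilbert_jets S s : witt_closed u w S -> forall d,
  (hilbert (fun f => S f /\ divides (l ^+ s) f) d)%:R =
  (hilbert (fun f => S f /\ divides (l ^+ s.+1) f) d)%:R +
  shift_series s (fun d => (hilbert (jets S s) d)%:R) d :> rat.
Proof.
move=> cS d; have [gS _] := cS.
have sT e : is_subspace (fun f => S f /\ divides (l ^+ e) f).
  by have [[]] := cap_power_closed e cS.
have gQ := graded_colon s gS; have [sQ hQ] := gQ.
have [[sI _] _] := jets_closed s cS.
rewrite /shift_series; case: leqP => sd; last first.
  have T0 e : (s <= e)%N -> forall f, homog_part (fun f => S f /\ divides (l ^+ e) f) d f -> f = 0.
    move=> se f [[_ [g fE]] hf]; rewrite -(pihomog_dE hf) fE.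
    by rewrite (pihomogM _ _ (linear_form_exp_homog e)) leqNgt (leq_trans sd se).
  by rewrite !hilbert0 ?addr0 //; [apply: T0|apply: T0].
have -> : d = (d - s + s)%N by rewrite subnK.
set d' := (d - s)%N; rewrite addnK.
pose K g := S (l ^+ s * g) /\ restrict i j g = 0.
have gK : graded_subspace K.
  split; [split|].
  - by split; [apply: subspace0 sQ|rewrite rmorph0].
  - move=> a f g [Sf f0] [Sg g0]; split; first by case: sQ => _; apply.
    by rewrite restrictD restrictZ f0 g0 scaler0 addr0.
  move=> d1 f [Sf f0]; split; first exact: hQ.
  by rewrite -pihomog_restrict f0 linear0.
have hom := linear_form_exp_homog s; have ne := linear_form_exp_neq0 s.
rewrite (hilbert_mul d' ne hom gQ (sT s)); last first.
  move=> f; split=> [[Sf [g fE]]|[g Sg ->]]; last by split=> //; exists g.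
  by exists g; rewrite -?fE.
rewrite (hilbert_mul d' ne hom gK (sT s.+1)); last first.
  move=> f; split=> [[Sf [g fE]]|[g [Sg /restrict_eq0[h gE]] ->]].
    exists (l * g); last by rewrite mulrA -exprSr.
    by split; [rewrite mulrA -exprSr -fE|rewrite restrictM restrict_linear_form mul0r].
  by split=> //; exists h; rewrite gE mulrA -exprSr.
rewrite -natrD; congr (_%:R).
apply: (@hilbert_rank_nullity k n n.-1 (restrict i j)) => //; first by case: gK.
  by move=> f; split=> [[[Sf f0] hf]|[[Sf hf] f0]].
move=> f'; split=> [[[g Sg ->] hg]|[g [Sg hg] ->]].
  exists (pihomog mdeg d' g); first by split; [apply: hQ|apply: pihomogP].
  by rewrite /= -pihomog_restrict pihomog_dE.
by split; [exists g|rewrite homog_piE pihomog_restrict pihomog_dE].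
Qed.

Lemma rational_of_cap S e : witt_closed u w S ->
  rational_series (fun d => (hilbert (fun f => S f /\ divides (l ^+ e) f) d)%:R : rat) ->
  rational_series (fun d => (hilbert S d)%:R : rat).
Proof.
move=> cS; elim: e => [|s IH] ratT.
  apply: eq_rational_series ratT => d; congr (_%:R); apply: eq_hilbert.
  - by have [[]] := cap_power_closed 0 cS.
  - by case: cS => -[].
  move=> f; split=> [[[Sf _] hf]|[Sf hf]] //; do !split=> //.
  by exists f; rewrite expr0 mul1r.
apply: IH; apply: (eq_rational_series (fun d => esym (hilbert_jets s cS d))).
apply: rational_seriesD => //; apply: rational_series_shift.
exact: IHrat (jets_closed s cS).
Qed.

End Jets.

Section JetFiltration.
Variables (k : fieldType) (n : nat) (u w : 'I_n -> nat).
Local Notation V := {mpoly k[n]}.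
Hypothesis IHchain : (0 < n)%N -> forall u' w', @chain_condition k n.-1 u' w'.
Hypothesis IHrat : (0 < n)%N -> forall u' w', @rational_condition k n.-1 u' w'.

(** A hyperplane exists only for [n > 0], the case in which the induction hypotheses are
    available. *)
Lemma index_pos (i : 'I_n) : (0 < n)%N.
Proof. exact: leq_ltn_trans (ltn_ord i). Qed.

Lemma jet_filtration_cons (S : V -> Prop) q fs e f :
  jet_filtration S (q :: fs) e f <->
  jet_filtration S fs e f /\ divides (linear_form k q.1 q.2 ^+ e) f.
Proof.
split=> [[Sf H]|[[Sf H] Hq]]; do !split=> //.
- by move=> r rfs; apply: H; rewrite inE rfs orbT.
- by apply: H; apply: mem_head.
by move=> r; rewrite inE => /predU1P[->|/H].
Qed.

Lemma jet_filtration_nil (S : V -> Prop) e f : jet_filtration S [::] e f <-> S f.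
Proof. by split=> [[]|Sf]. Qed.

Lemma eq_witt_closed (S S' : V -> Prop) : (forall f, S f <-> S' f) ->
  witt_closed u w S -> witt_closed u w S'.
Proof.
move=> E [[[S0 SD] gS] cS]; split; [split; [split|]|].
- exact/E.
- by move=> a f g /E Sf /E Sg; apply/E/SD.
- by move=> d f /E Sf; apply/E/gS.
by move=> m f m0 /E Sf; apply/E/cS.
Qed.

Lemma jet_filtration_closed (S : V -> Prop) fs e :
  witt_closed u w S -> witt_closed u w (jet_filtration S fs e).
Proof.
move=> cS; elim: fs => [|q fs IH].
  by apply: eq_witt_closed cS => f; rewrite jet_filtration_nil.
by apply: eq_witt_closed (cap_power_closed q.1 q.2 e IH) => f; rewrite jet_filtration_cons.
Qed.

Lemma stabilizes_of_jets (S : nat -> V -> Prop) fs e : increasing S ->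
  (forall t, witt_closed u w (S t)) ->
  stabilizes (fun t => jet_filtration (S t) fs e) -> stabilizes S.
Proof.
move=> incS cS; elim: fs => [|q fs IH] [J HJ].
  by exists J => t f /(jet_filtration_nil _ e)/HJ/jet_filtration_nil.
apply: IH; apply: (stabilizes_of_cap (i := q.1) (j := q.2) (IHchain (index_pos q.1)) (e := e)).
- by move=> t f [Sf H]; split=> //; apply: incS.
- by move=> t; apply: jet_filtration_closed.
by exists J => t f /jet_filtration_cons/HJ/jet_filtration_cons.
Qed.

Lemma rational_of_jets (S : V -> Prop) fs e : witt_closed u w S ->
  rational_series (fun d => (hilbert (jet_filtration S fs e) d)%:R : rat) ->
  rational_series (fun d => (hilbert S d)%:R : rat).
Proof.
move=> cS; elim: fs => [|q fs IH] ratT.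
  apply: eq_rational_series ratT => d; congr (_%:R); apply: eq_hilbert.
  - by have [[]] := jet_filtration_closed [::] e cS.
  - by case: cS => -[].
  by move=> f; split=> [[/jet_filtration_nil]|[/(jet_filtration_nil _ e)]].
apply: IH; have cT := jet_filtration_closed fs e cS.
apply: (rational_of_cap (i := q.1) (j := q.2) (IHrat (index_pos q.1)) (e := e) cT).
apply: eq_rational_series ratT => d; congr (_%:R); apply: eq_hilbert.
- by have [[]] := jet_filtration_closed (q :: fs) e cS.
- by have [[]] := cap_power_closed q.1 q.2 e cT.
by move=> f; split=> [[/jet_filtration_cons]|[/jet_filtration_cons]].
Qed.

End JetFiltration.

(** * Isolating one operator per variable *)

Lemma linear_fun0 (k : fieldType) (V W : lmodType k) (F : V -> W) : linear F -> F 0 = 0.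
Proof. by move=> linF; have := linF (-1) 0 0; rewrite scaler0 addr0 scaleN1r addNr. Qed.

Lemma linear_funZ (k : fieldType) (V W : lmodType k) (F : V -> W) (c : k) (x : V) :
  linear F -> F (c *: x) = c *: F x.
Proof. by move=> linF; have := linF c x 0; rewrite (linear_fun0 linF) !addr0. Qed.

Section LinearExtension.
Variables (k : fieldType) (n : nat) (V' : lmodType k).
Local Notation V := {mpoly k[n]}.

Definition monomial_lin (h : 'X_{1..n} -> V') (f : V) : V' :=
  \sum_(m <- msupp f) f@_m *: h m.

Lemma monomial_linX h m : monomial_lin h 'X_[m] = h m.
Proof. by rewrite /monomial_lin msuppX big_seq1 mcoeffX eqxx scale1r. Qed.

Lemma monomial_linE h f b : (msize f <= b)%N ->
  monomial_lin h f = \sum_(m : 'X_{1..n < b}) f@_m *: h m.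
Proof.
move=> fb; pose I : subFinType _ := 'X_{1..n < b}.
rewrite /monomial_lin (big_mksub I) //=; first last.
- by move=> m /msize_mdeg_lt /leq_trans /(_ fb) ->.
- exact: msupp_uniq.
by rewrite big_rmcond //= => m /memN_msupp_eq0 ->; rewrite scale0r.
Qed.

Lemma monomial_lin_linear h : linear (monomial_lin h).
Proof.
move=> a f g; pose b := maxn (msize (a *: f + g)) (maxn (msize f) (msize g)).
rewrite !(@monomial_linE _ _ b) ?leq_max ?leqnn ?orbT //.
rewrite scaler_sumr -big_split; apply: eq_bigr => m _ /=.
by rewrite mcoeffD mcoeffZ scalerDl scalerA.
Qed.

Lemma linear_param (W : lmodType k) (L : 'X_{1..n} -> W -> V') (f : V) :
  (forall m, linear (L m)) -> linear (fun x => monomial_lin (fun m => L m x) f).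
Proof.
move=> linL a x y; rewrite /monomial_lin scaler_sumr -big_split; apply: eq_bigr => m _ /=.
by rewrite linL scalerDr !scalerA mulrC.
Qed.

Lemma eq_linear_monomials (F G : V -> V') : linear F -> linear G ->
  (forall m, F 'X_[m] = G 'X_[m]) -> F =1 G.
Proof.
move=> linF linG E; elim/mpolyind => [|c m p _ _ IH]; last by rewrite linF linG E IH.
by rewrite !linear_fun0.
Qed.

End LinearExtension.

Lemma linear_sumf (k : fieldType) (V W : lmodType k) (I : Type) (r : seq I) (P : pred I)
    (F : I -> V -> W) :
  (forall i, linear (F i)) -> linear (fun x => \sum_(i <- r | P i) F i x).
Proof.
by move=> linF a x y; rewrite scaler_sumr -big_split; apply: eq_bigr => i _; rewrite linF.
Qed.

Lemma linear_addf (k : fieldType) (V W : lmodType k) (F G : V -> W) :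
  linear F -> linear G -> linear (fun x => F x + G x).
Proof. by move=> linF linG a x y; rewrite linF linG scalerDr addrACA. Qed.

Lemma linear_scalef (k : fieldType) (V W : lmodType k) (c : k) (F : V -> W) :
  linear F -> linear (fun x => c *: F x).
Proof. by move=> linF a x y; rewrite linF scalerDr !scalerA mulrC. Qed.

Lemma linear_compf (k : fieldType) (U V W : lmodType k) (G : V -> W) (F : U -> V) :
  linear G -> linear F -> linear (fun x => G (F x)).
Proof. by move=> linG linF a x y; rewrite linF linG. Qed.

Section Isolation.
Variables (k : fieldType) (n : nat) (u w : 'I_n -> nat).
Local Notation V := {mpoly k[n]}.
Implicit Types (f g Q : V) (m a : 'X_{1..n}) (js : seq 'I_n).

Definition site_op (i : 'I_n) (c : nat) f : V :=
  'X_i ^+ c * (euler i f + (u i + w i * c)%:R *: f).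

Lemma site_op_linear i c : linear (site_op i c).
Proof.
move=> x f g; rewrite /site_op (linearP (euler i)) scalerDr !scalerA [_%:R * x]mulrC -!scalerA.
by rewrite addrACA -scalerDr mulrDr scalerAr.
Qed.

Lemma site_opX i c a : site_op i c 'X_[a] = (a i + u i + w i * c)%:R *: 'X_[U_(i) *+ c + a].
Proof.
by rewrite /site_op eulerX -scalerDl -natrD addnA -scalerAr mpolyXD mpolyXn.
Qed.

Lemma twisted_witt_sites c f : twisted_witt u w c f = \sum_i site_op i c f.
Proof.
rewrite /twisted_witt /witt /twist mulr_suml -big_split; apply: eq_bigr => i _ /=.
by rewrite /site_op mulrDr -scalerAl -scalerAr.
Qed.

Definition iterated_witt (m : 'I_n -> nat) js f :=
  foldr (fun j g => twisted_witt u w (m j) g) f js.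

(** A word records on which variable each of the [r] successive operators acts. *)
Fixpoint words (r : nat) : seq (seq 'I_n) :=
  if r is r'.+1 then [seq i :: s | i <- enum 'I_n, s <- words r'] else [:: [::]].

Lemma size_words r s : s \in words r -> size s = r.
Proof.
elim: r s => [|r IH] s /=; first by rewrite inE => /eqP->.
by case/allpairsP => -[i s'] [/= _ /IH <- ->].
Qed.

Lemma mem_words s : s \in words (size s).
Proof.
by elim: s => [|i s IH] //=; apply/allpairsP; exists (i, s); rewrite mem_enum.
Qed.

Definition word_op (s : seq 'I_n) (m : 'I_n -> nat) js f :=
  foldr (fun q g => site_op q.1 (m q.2) g) f (zip s js).

Lemma word_op_linear s m js : linear (word_op s m js).
Proof.
rewrite /word_op; elim: (zip s js) => [|q r IH] //= x f g.
by rewrite IH site_op_linear.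
Qed.

Lemma iterated_witt_words m js f :
  iterated_witt m js f = \sum_(s <- words (size js)) word_op s m js f.
Proof.
elim: js => [|j js IH] /=; first by rewrite big_seq1.
rewrite IH twisted_witt_sites big_allpairs_dep /= big_enum /=; apply: eq_bigr => i _.
rewrite (big_morph (site_op i (m j)) (id1 := 0) (op1 := +%R)) //.
  by move=> f1 f2; have := site_op_linear i (m j) 1 f1 f2; rewrite !scale1r.
exact/linear_fun0/site_op_linear.
Qed.

Section Word.
Variables (phi : 'I_n -> 'I_n) (a : 'X_{1..n}).

(** The operators of the tail act first, so those on the same variable have already raised its
    exponent. *)
Fixpoint word_coef js m : nat :=
  if js is j :: js' then
    ((a (phi j) + \sum_(j' <- js' | phi j' == phi j) m j' + u (phi j) + w (phi j) * m j)
     * word_coef js' m)%N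
  else 1.

Lemma word_op_mapX m js :
  foldr (fun j g => site_op (phi j) (m j) g) 'X_[a] js =
  (word_coef js m)%:R *: 'X_[a + \sum_(j <- js) U_(phi j) *+ m j].
Proof.
elim: js => [|j js IH] /=; first by rewrite big_nil addm0 scale1r.
rewrite IH big_cons.
have := site_op_linear (phi j) (m j) (word_coef js m)%:R 'X_[a + \sum_(j0 <- js) U_(phi j0) *+ m j0] 0.
rewrite addr0 => ->.
rewrite (linear_fun0 (site_op_linear _ _)) addr0 site_opX scalerA mulrC -natrM; congr (_%:R *: 'X_[_]); last first.
  by rewrite addmC -!addmA; congr (_ + _)%MM; rewrite addmC.
congr (_ * _)%N; congr (_ + _ + _)%N; rewrite mnmDE mnm_sumE.
congr (_ + _)%N; rewrite [RHS]big_mkcond /=; apply: eq_bigr => j' _.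
by rewrite mulmnE mnm1E; case: eqP; rewrite ?mul1n ?mul0n.
Qed.

(** [word_coef] is polynomial in m; replacing each [m j] by [euler j] turns it into a differential
    operator acting on [Q]. *)
Definition symbol_step j js Q : V :=
  (a (phi j) + u (phi j))%:R *: Q + (w (phi j))%:R *: euler j Q
  + \sum_(j' <- js | phi j' == phi j) euler j' Q.

Fixpoint symbol_op js Q : V :=
  if js is j :: js' then symbol_step j js' (symbol_op js' Q) else Q.

Lemma symbol_step_linear j js : linear (symbol_step j js).
Proof.
apply: linear_addf; first apply: linear_addf.
- exact: linear_scalef.
- by apply: linear_scalef => x f g; apply: (linearP (euler j)).
by apply: linear_sumf => j' x f g; apply: (linearP (euler j')).
Qed.

Lemma symbol_op_linear js : linear (symbol_op js).
Proof. by elim: js => [|j js IH] //= x f g; rewrite IH symbol_step_linear. Qed.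

Lemma symbol_opX js m : symbol_op js 'X_[m] = (word_coef js m)%:R *: 'X_[m].
Proof.
elim: js => [|j js IH] /=; first by rewrite scale1r.
have := symbol_step_linear j js (word_coef js m)%:R 'X_[m] 0; rewrite addr0 IH => ->.
rewrite (linear_fun0 (symbol_step_linear _ _)) addr0 [in RHS]mulnC natrM -scalerA; congr (_ *: _).
rewrite /symbol_step eulerX scalerA -natrM -scalerDl -natrD.
rewrite (eq_bigr (fun j' => (m j')%:R *: 'X_[m])); last by move=> j' _; rewrite eulerX.
rewrite -scaler_suml -natr_sum -scalerDl -natrD; congr (_%:R *: _); lia.
Qed.

(** Each of the [size js] first-order steps lowers the power of [p] by at most one. *)
Lemma symbol_op_vanish p js s Q : exists Q',
  symbol_op js (p ^+ (size js + s) * Q) = p ^+ s * Q'.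
Proof.
elim: js s => [|j js IH] s /=; first by exists Q.
rewrite addSnnS; have [Q1 ->] := IH s.+1.
pose Y j' := s.+1%:R *: (euler j' p * Q1) + p * euler j' Q1.
have E j' : euler j' (p ^+ s.+1 * Q1) = p ^+ s * Y j'.
  have eX r : euler j' (p ^+ r.+1) = r.+1%:R *: (p ^+ r * euler j' p).
    elim: r => [|r IHr]; first by rewrite expr0 mul1r scale1r expr1.
    rewrite exprS eulerM IHr -scalerAr mulrA -exprS mulrC.
    by rewrite [in RHS]mulrS scalerDl scale1r.
  by rewrite eulerM eX /Y mulrDr -scalerAl -scalerAr !mulrA exprSr.
clearbody Y.
exists ((a (phi j) + u (phi j))%:R *: (p * Q1) + (w (phi j))%:R *: Y j +
  \sum_(j' <- js | phi j' == phi j) Y j').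
rewrite /symbol_step E (eq_bigr _ (fun j' _ => E j')) exprSr -mulrA.
by rewrite -mulr_sumr !mulrDr -!scalerAr.
Qed.

Definition word_subst : V -> V := comp_mpoly [tuple 'X_(phi j) | j < n].

Lemma word_substX m : word_subst 'X_[m] = 'X_[\sum_j U_(phi j) *+ m j].
Proof.
rewrite /word_subst comp_mpolyX -mprodXnE; apply: eq_bigr => j _.
by rewrite tnth_mktuple.
Qed.

(** The sum over m becomes a differential operator applied to [Q], followed by the substitution of
    x_(phi j) for x_j. *)
Lemma word_sum Q :
  \sum_(m <- msupp Q) Q@_m *: foldr (fun j g => site_op (phi j) (m j) g) 'X_[a] (enum 'I_n)
  = 'X_[a] * word_subst (symbol_op (enum 'I_n) Q).
Proof.
rewrite -/(monomial_lin _ _).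
apply: (eq_linear_monomials (F := monomial_lin _)
   (G := fun Q => 'X_[a] * word_subst (symbol_op (enum 'I_n) Q))) => [||m].
- exact: monomial_lin_linear.
- move=> x f g; rewrite symbol_op_linear /word_subst linearP /= mulrDr scalerAr //.
rewrite monomial_linX word_op_mapX symbol_opX /word_subst linearZ /= -/word_subst.
by rewrite word_substX -scalerAr mpolyXD big_enum.
Qed.

(** An operator of order at most n leaves one factor x_j1 - x_j2, which the substitution sends to
    0. *)
Lemma word_sum_vanish Q j1 j2 : phi j1 = phi j2 ->
  divides (('X_j1 - 'X_j2) ^+ n.+1) Q ->
  \sum_(m <- msupp Q) Q@_m *: foldr (fun j g => site_op (phi j) (m j) g) 'X_[a] (enum 'I_n)
  = 0.
Proof.
move=> E [Q0 QE]; rewrite word_sum QE.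
have := symbol_op_vanish ('X_j1 - 'X_j2) (enum 'I_n) 1 Q0.
rewrite size_enum_ord addn1 => -[Q' ->]; rewrite /word_subst rmorphM rmorphXn rmorphB /=.
by rewrite !comp_mpolyXU -!tnth_nth !tnth_mktuple E subrr expr1 mul0r mulr0.
Qed.

Lemma word_coef_inj js m : injective phi -> uniq js ->
  word_coef js m = (\prod_(j <- js) (a (phi j) + u (phi j) + w (phi j) * m j))%N.
Proof.
move=> inj; elim: js => [|j js IH] /=; first by rewrite big_nil.
move=> /andP[jjs /IH ->]; rewrite big_cons big_seq_cond big1 ?addn0 // => j'.
by case/andP => j'js /eqP/inj E; rewrite -E j'js in jjs.
Qed.

End Word.

Definition isolated_coef m a : nat := (\prod_i (a i + u i + w i * m i))%N.

(* The part of the composites L_{m_1} ... L_{m_n} in which every L_{m_j} acts *)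
(* on its own variable, extended linearly in the monomial m.                  *)
Definition isolated Q f : V :=
  monomial_lin (fun m => monomial_lin (fun a => (isolated_coef m a)%:R *: 'X_[m + a]) f) Q.

Lemma isolated_linearl f : linear (fun Q => isolated Q f).
Proof. exact: monomial_lin_linear. Qed.

Lemma isolated_linearr Q : linear (isolated Q).
Proof. by apply: linear_param => m; apply: monomial_lin_linear. Qed.

Lemma isolatedX m a : isolated 'X_[m] 'X_[a] = (isolated_coef m a)%:R *: 'X_[m + a].
Proof. by rewrite /isolated !monomial_linX. Qed.

(** An injective [phi] is a permutation, which the symmetry of [Q] absorbs. *)
Lemma word_sum_inj phi a Q : injective phi -> Q \is symmetric ->
  \sum_(m <- msupp Q) Q@_m *: foldr (fun j g => site_op (phi j) (m j) g) 'X_[a] (enum 'I_n)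
  = isolated Q 'X_[a].
Proof.
move=> inj symQ; rewrite word_sum; pose s : 'S_n := perm inj.
have symE : msym s Q = Q by move/issymP: symQ.
rewrite -{2}symE.
apply: (eq_linear_monomials (F := fun Q => 'X_[a] * word_subst phi (symbol_op phi a (enum 'I_n) Q))
   (G := fun Q => isolated (msym s Q) 'X_[a])) => [||m].
- by move=> x f g; rewrite symbol_op_linear /word_subst linearP /= mulrDr scalerAr.
- by apply: linear_compf (isolated_linearl _) _ => x f g; rewrite msymD msymZ.
rewrite msymX isolatedX symbol_opX /word_subst linearZ /= -/(word_subst phi _).
rewrite word_substX -scalerAr -mpolyXD addmC word_coef_inj ?enum_uniq //.
congr (_%:R *: 'X_[_]).
  rewrite big_enum /= /isolated_coef [RHS](reindex_inj (@perm_inj _ s)) /=.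
  by apply: eq_bigr => j _; rewrite mnmE permK permE.
congr (_ + _)%MM; rewrite [RHS]multinomUE_id [RHS](reindex_inj (@perm_inj _ s)) /=.
by apply: eq_bigr => j _; rewrite mnmE permK permE.
Qed.

(** Expand the combination of the L_(m_1) ... L_(m_n) f with coefficients from [Q] over words. Words
    with a repeated variable contribute 0, all others [isolated Q f], so the sum is a positive
    integer multiple of it. *)
Lemma isolated_in_closed (k0 : [pchar k] =i pred0) (S : V -> Prop) Q f :
  witt_closed u w S -> Q \is symmetric ->
  (forall j1 j2 : 'I_n, j1 != j2 -> divides (('X_j1 - 'X_j2) ^+ n.+1) Q) ->
  (forall m, m \in msupp Q -> forall j, (0 < m j)%N) ->
  S f -> S (isolated Q f).
Proof.
move=> [[sS gS] cS] symQ divQ posQ Sf.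
pose G s f := \sum_(m <- msupp Q) Q@_m *: word_op s m (enum 'I_n) f.
have Gs s : s \in words n -> G s f = (uniq s)%:R *: isolated Q f.
  move=> sw; have szs := size_words sw.
  apply: (eq_linear_monomials (F := G s) (G := fun f => (uniq s)%:R *: isolated Q f)) => [||a].
  - by apply: linear_sumf => m; apply/linear_scalef/word_op_linear.
  - by apply/linear_scalef/isolated_linearr.
  pose phi j := nth j s j.
  have sE : s = [seq phi j | j <- enum 'I_n].
    case: (posnP n) => [n0|n0].
      have /size0nil-> : size s = 0%N by rewrite szs.
      by have /size0nil-> : size (enum 'I_n) = 0%N by rewrite size_enum_ord.
    pose j0 := Ordinal n0; apply: (@eq_from_nth _ j0); first by rewrite size_map size_enum_ord.
    rewrite szs => i lt; rewrite (nth_map j0) ?size_enum_ord // /phi nth_enum_ord //.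
    by apply: set_nth_default; rewrite szs.
  have zE : zip s (enum 'I_n) = [seq (phi j, j) | j <- enum 'I_n].
    by rewrite [X in zip X _]sE -[X in zip _ X]map_id zip_map.
  have GE : G s 'X_[a] = \sum_(m <- msupp Q) Q@_m *:
       foldr (fun j g => site_op (phi j) (m j) g) 'X_[a] (enum 'I_n).
    apply: eq_bigr => m _; congr (_ *: _); rewrite /word_op zE.
    by elim: (enum 'I_n) => //= j js ->.
  rewrite GE; case: (boolP (uniq s)) => us.
    rewrite scale1r; apply: word_sum_inj => // j1 j2 E; apply/val_inj/eqP.
    rewrite -(nth_uniq j1 _ _ us) ?szs ?ltn_ord //; apply/eqP.
    by rewrite -/(phi j1) E /phi; apply: set_nth_default; rewrite szs ltn_ord.
  rewrite scale0r.
  have /injectivePn[j1 [j2 ne E]] : ~~ injectiveb phi.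
    apply: contra us => /injectiveP inj.
    by rewrite [X in uniq X]sE map_inj_uniq ?enum_uniq.
  apply: word_sum_vanish E _; exact: divQ.
have SG : S (\sum_(s <- words n) G s f).
  rewrite /G exchange_big /=; apply: subspace_sum => // m mQ _.
  rewrite -scaler_sumr; apply: subspaceZ => //.
  have := iterated_witt_words m (enum 'I_n) f; rewrite size_enum_ord => <-.
  rewrite /iterated_witt; elim: (enum 'I_n) => //= j js IH.
  by apply: cS => //; apply: posQ.
move: SG; rewrite big_seq (eq_bigr (fun s => (uniq s)%:R *: isolated Q f)) //.
rewrite -big_seq -scaler_suml -natr_sum; apply: subspace_scale_cancel => //.
rewrite char0_natr_eq0 // -lt0n.
have e0 : enum 'I_n \in words n by have := mem_words (enum 'I_n); rewrite size_enum_ord.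
by rewrite (big_rem _ e0) /= enum_uniq.
Qed.

End Isolation.

(** * The top coefficient of a composite of two isolated operators *)

Lemma coef_prod_top (R : comNzRingType) (I : Type) (s : seq I) (p : I -> {poly R}) (e : I -> nat) :
  (forall i, (size (p i) <= (e i).+1)%N) ->
  (size (\prod_(i <- s) p i)%R <= (\sum_(i <- s) e i).+1)%N /\
  (\prod_(i <- s) p i)`_(\sum_(i <- s) e i) = \prod_(i <- s) (p i)`_(e i).
Proof.
move=> sz; elim: s => [|i s [IHs IHc]]; first by rewrite !big_nil size_poly1 coef1.
rewrite !big_cons; set q := \prod_(_ <- s) _ in IHs IHc *; set b := (\sum_(_ <- s) _)%N in IHs IHc *.
split.
  apply: leq_trans (size_polyMleq _ _) _.
  by have := sz i; lia.
rewrite coefM (bigD1 (inord (e i))) //= inordK ?ltnS ?leq_addr // addKn IHc.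
rewrite [X in _ + X]big1 ?addr0 // => j /eqP ne; case: (ltngtP j (e i)) => lt.
- by rewrite [q`_ _]nth_default ?mulr0 //; apply: leq_trans IHs _; lia.
- by rewrite [(p i)`_ _]nth_default ?mul0r //; apply: leq_trans (sz i) _.
by case: ne; apply/val_inj; rewrite /= inordK ?lt ?ltnS ?leq_addr.
Qed.

Section TopCoefficient.
Variables (k : fieldType) (n : nat) (u w : 'I_n -> nat).
Hypothesis k0 : [pchar k] =i pred0.
Local Notation V := {mpoly k[n]}.
Implicit Types (f g P Q : V) (m a : 'X_{1..n}).

(** Bounds the degree in b of the i-th factor [shift_factor]: for w_i = 0 one of its two linear
    factors is constant. For w_i = 1 the coefficient in degree 2 is 0, hence the later assumption
    that no weight is 1. *)
Definition shift_degree (i : 'I_n) : nat := if w i == 0%N then 1 else 2.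
Definition total_shift : nat := (\sum_i shift_degree i)%N.
Local Notation r := total_shift.

Definition site_eigenvalue (i : 'I_n) a : k :=
  if w i == 0%N then - (a i + u i)%:R else - (w i * (w i - 1))%:R.

Definition diagonal_op (c : 'X_{1..n} -> k) f : V :=
  monomial_lin (fun a => c a *: 'X_[a]) f.

Lemma diagonal_op_linear c : linear (diagonal_op c).
Proof. exact: monomial_lin_linear. Qed.
HB.instance Definition _ c :=
  GRing.isLinear.Build k V V _ (diagonal_op c) (diagonal_op_linear c).

Lemma diagonal_opX c a : diagonal_op c 'X_[a] = c a *: 'X_[a].
Proof. exact: monomial_linX. Qed.

Definition eigenvalue_product a : k := \prod_i site_eigenvalue i a.

Definition all_vars : V := \prod_(i < n) 'X_i.

Lemma all_varsE b : all_vars ^+ b = 'X_[[multinom b | _ < n]].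
Proof.
rewrite /all_vars -prodrXl mpolyXE_id; apply: eq_bigr => i _; by rewrite mnmE.
Qed.

Lemma all_vars_sym : all_vars \is symmetric.
Proof. by rewrite /all_vars -mesymnnE mesym_sym. Qed.

(* Its values at b = 0, ..., r are the i-th factors of the coefficients of    *)
(* isolated (Q F^b) (isolated (Q' F^(r-b)) f), where F is the product of the  *)
(* variables.                                                                 *)
Definition shift_factor m m' a i : {poly k} :=
  ((a i + m' i + r + u i + w i * m i)%:R%:P + ((w i)%:R - 1) *: 'X) *
  ((a i + u i + w i * (m' i + r))%:R%:P - (w i)%:R *: 'X).

Lemma shift_factor_eval m m' a i b : (b <= r)%N ->
  (shift_factor m m' a i).[b%:R] =
  (a i + (m' i + (r - b)) + u i + w i * (m i + b))%:R * (a i + u i + w i * (m' i + (r - b)))%:R.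
Proof.
move=> br; rewrite /shift_factor !hornerE; congr (_ * _).
  have {1}-> : r = (r - b + b)%N by rewrite subnK.
  by rewrite !(natrD, natrM); ring.
have {1}-> : r = (r - b + b)%N by rewrite subnK.
by rewrite !(natrD, natrM); ring.
Qed.

Lemma size_shift_factor m m' a i : (size (shift_factor m m' a i) <= (shift_degree i).+1)%N.
Proof.
have s1 (x y : k) : (size (x%:P + y *: 'X)%R <= 2)%N.
  apply: leq_trans (size_polyD _ _) _; rewrite geq_max (leq_trans (size_polyC_leq1 x)) //=.
  by apply: leq_trans (size_scale_leq _ _) _; rewrite size_polyX.
rewrite /shift_factor /shift_degree; case: eqP => [->|_].
  rewrite scale0r subr0; apply: leq_trans (size_polyMleq _ _) _.
  rewrite -subn1 leq_subLR; exact: leq_add (s1 _ _) (size_polyC_leq1 _).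
rewrite -scaleNr; apply: leq_trans (size_polyMleq _ _) _.
rewrite -subn1 leq_subLR; exact: leq_add (s1 _ _) (s1 _ _).
Qed.

Lemma coef_shift_factor m m' a i :
  (shift_factor m m' a i)`_(shift_degree i) = site_eigenvalue i a.
Proof.
rewrite /shift_factor /shift_degree /site_eigenvalue; case: eqP => [->|/eqP w0].
  rewrite scale0r subr0 coefMC coefD coefC coefZ coefX /= mulr1 add0r sub0r mulN1r.
  by rewrite mul0n addn0.
rewrite coefM !big_ord_recl big_ord0 /= !(coefB, coefD, coefC, coefZ, coefX) /=.
have -> : (w i * (w i - 1))%:R = (w i)%:R * ((w i)%:R - 1) :> k.
  by rewrite natrM natrB // lt0n.
rewrite /bump /=; ring.
Qed.

(** The powers b and r - b of [all_vars] add up to r, so only the scalars depend on b; this collects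
    the terms in b^t. *)
Definition shift_coef t Q Q' f : V :=
  monomial_lin (fun m => monomial_lin (fun m' => monomial_lin (fun a =>
    (\prod_i shift_factor m m' a i)`_t *: ('X_[m + m' + a] * all_vars ^+ r)) f) Q') Q.

Lemma shift_coef_linear1 t Q' f : linear (fun Q => shift_coef t Q Q' f).
Proof. exact: monomial_lin_linear. Qed.

Lemma shift_coef_linear2 t Q f : linear (fun Q' => shift_coef t Q Q' f).
Proof. by apply: linear_param => m; apply: monomial_lin_linear. Qed.

Lemma shift_coef_linear3 t Q Q' : linear (shift_coef t Q Q').
Proof.
by apply: linear_param => m; apply: linear_param => m'; apply: monomial_lin_linear.
Qed.

Lemma mulr_linear_r (Z : V) : linear (fun f : V => f * Z).
Proof. by move=> x f g; rewrite mulrDl scalerAl. Qed.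

Lemma mulr_linear_l (Z : V) : linear (fun f : V => Z * f).
Proof. by move=> x f g; rewrite mulrDr scalerAr. Qed.

Lemma isolated_shift b Q Q' f : (b <= r)%N ->
  isolated u w (Q * all_vars ^+ b) (isolated u w (Q' * all_vars ^+ (r - b)) f) =
  \sum_(t < r.+1) (b%:R ^+ t) *: shift_coef t Q Q' f.
Proof.
move=> br.
apply: (eq_linear_monomials
  (F := fun Q => isolated u w (Q * all_vars ^+ b) (isolated u w (Q' * all_vars ^+ (r - b)) f))
  (G := fun Q => \sum_(t < r.+1) (b%:R ^+ t) *: shift_coef t Q Q' f)) => [||m].
- by apply: linear_compf (isolated_linearl _ _ _) (mulr_linear_r _).
- by apply: linear_sumf => t; apply/linear_scalef/shift_coef_linear1.
apply: (eq_linear_monomials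
  (F := fun Q' => isolated u w ('X_[m] * all_vars ^+ b) (isolated u w (Q' * all_vars ^+ (r - b)) f))
  (G := fun Q' => \sum_(t < r.+1) (b%:R ^+ t) *: shift_coef t 'X_[m] Q' f)) => [||m'].
- apply: linear_compf (isolated_linearr _ _ _) _.
  by apply: linear_compf (isolated_linearl _ _ _) (mulr_linear_r _).
- by apply: linear_sumf => t; apply/linear_scalef/shift_coef_linear2.
apply: (eq_linear_monomials
  (F := fun f => isolated u w ('X_[m] * all_vars ^+ b) (isolated u w ('X_[m'] * all_vars ^+ (r - b)) f))
  (G := fun f => \sum_(t < r.+1) (b%:R ^+ t) *: shift_coef t 'X_[m] 'X_[m'] f)) => [||a].
- by apply: linear_compf (isolated_linearr _ _ _) (isolated_linearr _ _ _).
- by apply: linear_sumf => t; apply/linear_scalef/shift_coef_linear3.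
rewrite (eq_bigr (fun t : 'I_r.+1 => (b%:R ^+ t * (\prod_i shift_factor m m' a i)`_t) *:
    ('X_[m + m' + a] * all_vars ^+ r))); last first.
  by move=> t _; rewrite /shift_coef !monomial_linX scalerA.
rewrite -scaler_suml.
have -> : \sum_(t < r.+1) b%:R ^+ t * (\prod_i shift_factor m m' a i)`_t =
    \prod_i (shift_factor m m' a i).[b%:R].
  have [sz _] := coef_prod_top (index_enum 'I_n) (size_shift_factor m m' a).
  rewrite -horner_prod (horner_coef_wide _ sz).
  by apply: eq_bigr => t _; rewrite mulrC.
rewrite (eq_bigr _ (fun i _ => shift_factor_eval m m' a i br)) big_split /=.
rewrite !all_varsE -!mpolyXD isolatedX.
rewrite (linear_funZ _ _ (isolated_linearr u w _)) isolatedX scalerA.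
rewrite -!natr_prod -!natrM; congr (_%:R *: 'X_[_]); last first.
  by apply/mnmP => i; rewrite !mnmE; lia.
rewrite mulnC /isolated_coef; congr (_ * _)%N; apply: eq_bigr => i _; rewrite !mnmE; lia.
Qed.

Lemma shift_coef_top Q Q' f :
  shift_coef r Q Q' f = Q * Q' * all_vars ^+ r * diagonal_op eigenvalue_product f.
Proof.
apply: (eq_linear_monomials (F := fun Q => shift_coef r Q Q' f)
  (G := fun Q => Q * Q' * all_vars ^+ r * diagonal_op eigenvalue_product f)) => [||m].
- exact: shift_coef_linear1.
- do 2!apply: linear_compf (mulr_linear_r _) _; exact: mulr_linear_r.
apply: (eq_linear_monomials (F := fun Q' => shift_coef r 'X_[m] Q' f)
  (G := fun Q' => 'X_[m] * Q' * all_vars ^+ r * diagonal_op eigenvalue_product f)) => [||m'].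
- exact: shift_coef_linear2.
- do 2!apply: linear_compf (mulr_linear_r _) _; exact: mulr_linear_l.
apply: (eq_linear_monomials (F := fun f => shift_coef r 'X_[m] 'X_[m'] f)
  (G := fun f => 'X_[m] * 'X_[m'] * all_vars ^+ r * diagonal_op eigenvalue_product f)) => [||a].
- exact: shift_coef_linear3.
- apply: linear_compf (mulr_linear_l _) _; exact: diagonal_op_linear.
rewrite /shift_coef !monomial_linX diagonal_opX.
have [_ ->] := coef_prod_top (index_enum 'I_n) (size_shift_factor m m' a).
rewrite (eq_bigr _ (fun i _ => coef_shift_factor m m' a i)) -/(eigenvalue_product a).
by rewrite -scalerAr !mpolyXD mulrAC.
Qed.

(** The requirements of [isolated_in_closed] in a form preserved by symmetric multiples;
    divisibility by [all_vars] makes all exponents positive. *)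
Definition isolating Q :=
  [/\ Q \is symmetric,
      forall j1 j2 : 'I_n, j1 != j2 -> divides (('X_j1 - 'X_j2) ^+ n.+1) Q &
      divides all_vars Q].

Lemma dividesMr p Q P : divides p Q -> divides p (Q * P).
Proof. by move=> [R ->]; exists (R * P); rewrite mulrA. Qed.

Lemma isolatingM Q P : isolating Q -> P \is symmetric -> isolating (Q * P).
Proof.
move=> [sQ dQ vQ] sP; split; first exact: rpredM.
  by move=> j1 j2 ne; apply: dividesMr; apply: dQ.
exact: dividesMr.
Qed.

Lemma isolating_in_closed (S : V -> Prop) Q f :
  witt_closed u w S -> isolating Q -> S f -> S (isolated u w Q f).
Proof.
move=> cS [sQ dQ [Q1 QE]]; apply: isolated_in_closed => // m.
rewrite QE mulrC -[all_vars]expr1 all_varsE (perm_mem (msuppMX _ _)).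
by case/mapP => m0 _ -> j; rewrite mnmDE mnmE.
Qed.

(** The composites for b = 0, ..., r lie in [S], hence so does their coefficient of b^r. *)
Lemma top_coef_in_closed (S : V -> Prop) Q Q' f :
  witt_closed u w S -> isolating Q -> isolating Q' -> S f ->
  S (Q * Q' * all_vars ^+ r * diagonal_op eigenvalue_product f).
Proof.
move=> cS iQ iQ' Sf; rewrite -shift_coef_top; have [[sS _] _] := cS.
apply: (polynomial_values_coef k0 sS (N := r.+1) (c := fun t => shift_coef t Q Q' f)) => // b br.
rewrite -isolated_shift //; have sF b' : all_vars ^+ b' \is symmetric.
  by apply: rpredX; apply: all_vars_sym.
apply: isolating_in_closed => //; first exact: isolatingM.
by apply: isolating_in_closed => //; apply: isolatingM.
Qed.

(** Both orders of each pair are taken, which makes the product symmetric. Up to sign every form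
    occurs exactly twice: x_i comes from a diagonal pair and from [all_vars]. *)
Definition arrangement : V :=
  (\prod_(q : 'I_n * 'I_n) linear_form k q.1 q.2) * all_vars.

Lemma msymXU (s : 'S_n) i : msym s 'X_i = 'X_(s i) :> V.
Proof. by rewrite /msym mmapX mmap1U. Qed.

Lemma arrangement_form_sym : \prod_(q : 'I_n * 'I_n) linear_form k q.1 q.2 \is symmetric.
Proof.
apply/issymP => s; rewrite rmorph_prod /=.
have inj : injective (fun q : 'I_n * 'I_n => (s q.1, s q.2)).
  by move=> [a b] [c d] [/perm_inj-> /perm_inj->].
rewrite [RHS](reindex_inj inj); apply: eq_bigr => -[a b] _ /=.
rewrite /linear_form (inj_eq (@perm_inj _ s)); by case: ifP => _; rewrite ?msymB !msymXU.
Qed.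

Lemma arrangement_in_closed : exists K, forall (S : V -> Prop) f P,
  witt_closed u w S -> P \is symmetric -> S f ->
  S (arrangement ^+ K * P * diagonal_op eigenvalue_product f).
Proof.
(* Two isolating factors [all_vars * A ^+ n.+1] and the factor [all_vars ^+ r] of the top
   coefficient are used; what is left over is symmetric and joins [P]. *)
exists (r + 2 * n.+1)%N => S f P cS sP Sf.
pose A : V := \prod_(q : 'I_n * 'I_n) linear_form k q.1 q.2.
have sA : A \is symmetric by apply: arrangement_form_sym.
have iQ : isolating (all_vars * A ^+ n.+1).
  split; first by rewrite rpredM ?rpredX ?all_vars_sym.
    move=> j1 j2 ne; rewrite /A (bigD1 (j1, j2)) //= /linear_form (negbTE ne) exprMn_comm //.
      by rewrite mulrCA; eexists; reflexivity.
    exact: mulrC.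
  by eexists; reflexivity.
have -> : arrangement ^+ (r + 2 * n.+1) * P =
  (all_vars * A ^+ n.+1 * (A ^+ r * all_vars ^+ (2 * n) * P)) * (all_vars * A ^+ n.+1) * all_vars ^+ r.
  rewrite /arrangement -/A exprMn_comm; last exact: mulrC.
  have -> : A ^+ (r + 2 * n.+1) = A ^+ n.+1 * A ^+ r * A ^+ n.+1.
    by rewrite -!exprD; congr (_ ^+ _); lia.
  have -> : all_vars ^+ (r + 2 * n.+1) = all_vars * all_vars ^+ (2 * n) * all_vars * all_vars ^+ r.
    by rewrite -exprS -exprSr -exprD; congr (_ ^+ _); lia.
  ring.
apply: top_coef_in_closed => //; apply: isolatingM => //.
by rewrite !rpredM ?rpredX ?all_vars_sym.
Qed.

End TopCoefficient.

(** * The symmetric submodule *)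

Section AdNilpotent.
Variables (k : fieldType) (n : nat) (H : {mpoly k[n]}).
Local Notation V := {mpoly k[n]}.
Implicit Types (X Y D : V -> V) (U : V -> Prop).

(** The commutator of multiplication by [H] with [X]; it lowers the order of a differential
    operator. *)
Definition ad X : V -> V := fun g => H * X g - X (H * g).

(** The commutator of [H] with the derivation [D] is multiplication by - D H, which commutes with
    [H]. For r = 0 the truncated [r.-1] has coefficient 0. *)
Lemma ad_leibniz_iter D (c : k) X r g : linear D ->
  (forall f g, D (f * g) = D f * g + f * D g) ->
  iter r ad (fun g => D (X g) + c *: X g) g =
  D (iter r ad X g) + c *: iter r ad X g - r%:R *: (D H * iter r.-1 ad X g).
Proof.
move=> linD derD; elim: r g => [|r IH] g; first by rewrite /= scale0r subr0.
rewrite iterS /ad !IH.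
have -> : iter r.+1 ad X g = H * iter r ad X g - iter r ad X (H * g) by [].
have -> : iter r.+1.-1 ad X g = iter r ad X g by [].
have E : r%:R *: (D H * (H * iter r.-1 ad X g - iter r.-1 ad X (H * g))) =
    r%:R *: (D H * iter r ad X g).
  by case: r {IH} => [|r]; first by rewrite !scale0r.
have DB x y : D (x - y) = D x - D y.
  by rewrite -[- y]scaleN1r -[- D y]scaleN1r addrC linD addrC.
rewrite DB derD -[r.+1]addn1 natrD scalerDl -E.
by rewrite -!mul_mpolyC mpolyC1; ring.
Qed.

Lemma ad_vanish_comp D (c : k) X r : linear D ->
  (forall f g, D (f * g) = D f * g + f * D g) ->
  (forall g, iter r ad X g = 0) ->
  forall g, iter r.+1 ad (fun g => D (X g) + c *: X g) g = 0.
Proof.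
move=> linD derD X0 g; rewrite ad_leibniz_iter // [r.+1.-1]/= X0 /= /ad !X0.
by rewrite mulr0 subr0 (linear_fun0 linD) scaler0 !mulr0 scaler0 subr0 addr0.
Qed.

(** The iterated commutator is an alternating binomial sum of the H^(r-b) X (H^b g), whose term at b
    = 0 is H^r X g. *)
Lemma ad_expansion U X r Z g : is_subspace U ->
  (forall b, (0 < b <= r)%N -> U (Z * H ^+ (r - b) * X (H ^+ b * g))) ->
  U (Z * (iter r ad X g - H ^+ r * X g)).
Proof.
move=> sU; elim: r Z g => [|r IH] Z g Ub /=.
  by rewrite expr0 mul1r subrr mulr0; apply: subspace0.
have -> : Z * (ad (iter r ad X) g - H ^+ r.+1 * X g) =
  (Z * H) * (iter r ad X g - H ^+ r * X g) - Z * (iter r ad X (H * g) - H ^+ r * X (H * g))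
  - Z * H ^+ r * X (H ^+ 1 * g).
  by rewrite /ad exprS expr1; ring.
apply: subspaceB => //; last by have := Ub 1%N (ltn0Sn _); rewrite subn1.
apply: subspaceB => //; apply: IH => b /andP[b0 br].
  rewrite -[Z * H * _]mulrA -exprS -subSn //; apply: Ub.
  by rewrite b0 (leq_trans br).
have := Ub b.+1; rewrite subSS exprSr -[H ^+ b * H * g]mulrA; apply.
by rewrite ltnS.
Qed.

End AdNilpotent.

(** * Removing the diagonal operator *)

Section SymmetricSubmodule.
Variables (k : fieldType) (n : nat) (u w : 'I_n -> nat).
Hypothesis k0 : [pchar k] =i pred0.
Hypothesis w1 : forall i, w i != 1%N.
Local Notation V := {mpoly k[n]}.
Local Notation B := (arrangement k n).
Local Notation eop := (diagonal_op (@eigenvalue_product k n u w)).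
Implicit Types (f g P : V) (S : V -> Prop).

(** The eigenvalue written as a derivation plus a scalar, the form required by [ad_vanish_comp]. *)
Definition site_diag i f : V :=
  (if w i == 0%N then - euler i f else 0) +
  (if w i == 0%N then - (u i)%:R else - (w i * (w i - 1))%:R) *: f.

Lemma site_diagX i a : site_diag i 'X_[a] = site_eigenvalue k u w i a *: 'X_[a].
Proof.
rewrite /site_diag /site_eigenvalue; case: ifP => _; last by rewrite add0r.
by rewrite eulerX -scaleNr -scalerDl natrD opprD.
Qed.

Definition site_diags (s : seq 'I_n) f := foldr site_diag f s.

Lemma site_derivation_linear i : linear (fun f : V => if w i == 0%N then - euler i f else 0).
Proof.
move=> a f g; case: ifP => _; last by rewrite scaler0 addr0.
by rewrite (linearP (euler i)) opprD scalerN.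
Qed.

Lemma site_derivation_leibniz i f g :
  (if w i == 0%N then - euler i (f * g) else 0 : V) =
  (if w i == 0%N then - euler i f else 0) * g + f * (if w i == 0%N then - euler i g else 0).
Proof.
case: ifP => _; last by rewrite mul0r mulr0 addr0.
by rewrite eulerM mulNr mulrN opprD.
Qed.

Lemma ad_site_diags H (s : seq 'I_n) g : iter (size s).+1 (ad H) (site_diags s) g = 0.
Proof.
elim: s g => [|i s IH] g; first by rewrite /= /ad /site_diags /= subrr.
exact: (ad_vanish_comp (X := site_diags s) _ (site_derivation_linear i)
  (site_derivation_leibniz i) IH).
Qed.

Lemma site_diag_linear i : linear (site_diag i).
Proof. by apply: linear_addf (site_derivation_linear i) _; apply: linear_scalef. Qed.

Lemma eigen_op_sites f : eop f = site_diags (enum 'I_n) f.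
Proof.
apply: (eq_linear_monomials (F := eop) (G := site_diags (enum 'I_n))) => [||a].
- exact: diagonal_op_linear.
- by elim: (enum 'I_n) => [|i s IH] //=; apply: linear_compf (site_diag_linear i) IH.
rewrite diagonal_opX /eigenvalue_product -big_enum /=.
elim: (enum 'I_n) => [|i s IH] /=; first by rewrite big_nil scale1r.
rewrite -IH (linear_funZ _ _ (site_diag_linear i)) site_diagX scalerA big_cons mulrC //.
Qed.

Lemma arrangement_sym N : B ^+ N \is symmetric.
Proof. by rewrite rpredX // rpredM ?arrangement_form_sym ?all_vars_sym. Qed.

(** Quantifying over [P] yields a module over the symmetric polynomials, which [S] itself need not
    be. *)
Definition sym_part S (N : nat) g := forall P, P \is symmetric -> S (B ^+ N * P * g).

Definition sym_radical S g := exists N, sym_part S N g.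

Lemma sym_part_subspace S N : is_subspace S -> is_subspace (sym_part S N).
Proof.
move=> sS; split=> [P _|a f g Sf Sg P sP]; first by rewrite mulr0; apply: subspace0.
by rewrite mulrDr -scalerAr; case: sS => _; apply; [apply: Sf|apply: Sg].
Qed.

Lemma sym_part_le S N M g : (N <= M)%N -> sym_part S N g -> sym_part S M g.
Proof.
move=> /subnK <- Sg P sP; rewrite addnC exprD -[X in X * g]mulrA; apply: Sg.
by rewrite rpredM ?arrangement_sym.
Qed.

Lemma sym_radical_subspace S : is_subspace S -> is_subspace (sym_radical S).
Proof.
move=> sS; split; first by exists 0%N; apply: subspace0; apply: sym_part_subspace.
move=> a f g [N Sf] [M Sg]; exists (maxn N M).
case: (sym_part_subspace (maxn N M) sS) => _; apply.
  exact: sym_part_le (leq_maxl _ _) Sf.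
exact: sym_part_le (leq_maxr _ _) Sg.
Qed.

(* [eop] has order at most n, so the (n+1)-st iterate of ad (B^N) kills it and *)
(* (B^N)^(n+1) eop g is a combination of the (B^N)^(n+1-b) eop ((B^N)^b g)    *)
(* with b > 0.                                                                *)
Lemma sym_radical_eigen S g : witt_closed u w S -> sym_radical S g -> sym_radical S (eop g).
Proof.
move=> cS [N Sg]; have [K HK] := arrangement_in_closed u w k0.
have [[sS _] _] := cS; exists (K + N * n.+1)%N => P sP.
have := @ad_expansion _ _ (B ^+ N) S (site_diags (enum 'I_n)) n.+1 (B ^+ K * P) g sS.
have := ad_site_diags (B ^+ N) (enum 'I_n) g; rewrite size_enum_ord => ->.
rewrite sub0r mulrN -eigen_op_sites => H.
have {}H : S (- (B ^+ K * P * (B ^+ N) ^+ n.+1 * eop g)).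
  rewrite -mulrA; apply: H => b /andP[b0 _]; rewrite -eigen_op_sites -[B ^+ K * P * _]mulrA.
  apply: HK => //; first by rewrite rpredM // rpredX ?arrangement_sym.
  case: b b0 => // b _; rewrite exprS; apply: Sg; by rewrite rpredX ?arrangement_sym.
have := subspaceN sS H; rewrite opprK exprD exprM.
by rewrite -[X in S (X * _)]mulrA [P * _]mulrC mulrA.
Qed.

(** The eigenvalues of [eop] on the monomials of [f] are nonzero, since exponents are positive and
    no weight is 1. So a polynomial in [eop] with nonzero constant term kills [f], and [f] is a
    combination of its images under positive powers of [eop], which lie in the radical. *)
Lemma sym_radical_mem S f : witt_closed u w S ->
  (forall a, a \in msupp f -> forall i, (0 < a i)%N) -> S f -> sym_radical S f.
Proof.
move=> cS pos Sf; have [[sS _] _] := cS; have sR := sym_radical_subspace sS.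
have iterE j : sym_radical S (iter j.+1 eop f).
  elim: j => [|j IH]; last exact: sym_radical_eigen.
  have [K HK] := arrangement_in_closed u w k0.
  by exists K => P sP; apply: HK.
pose v := @eigenvalue_product k n u w.
pose p := \prod_(a <- msupp f) ('X - (v a)%:P).
have p0 : p`_0 != 0.
  rewrite -horner_coef0 horner_prod prodf_seq_neq0; apply/allP => a af.
  rewrite hornerXsubC sub0r oppr_eq0; apply/prodf_neq0 => i _.
  rewrite /site_eigenvalue; case: (eqVneq (w i) 0%N) => [_|w0]; rewrite oppr_eq0 char0_natr_eq0 //.
    by have := pos a af i; lia.
  by rewrite muln_eq0 (negbTE w0) subn_eq0 -ltnNge ltn_neqAle eq_sym w1 lt0n.
have powE j : iter j eop f = \sum_(a <- msupp f) (f@_a * v a ^+ j) *: 'X_[a].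
  elim: j => [|j IH] /=; first by rewrite [LHS]mpolyE; apply: eq_bigr => a _; rewrite expr0 mulr1.
  rewrite IH linear_sum; apply: eq_bigr => a _ /=.
  by rewrite (linear_funZ _ _ (diagonal_op_linear _)) diagonal_opX scalerA exprSr mulrA.
have : \sum_(j < size p) p`_j *: iter j eop f = 0.
  under eq_bigr do rewrite powE scaler_sumr.
  rewrite exchange_big /= big_seq big1 // => a af.
  under eq_bigr do rewrite scalerA mulrCA.
  rewrite -scaler_suml -mulr_sumr -horner_coef.
  have -> : p.[v a] = 0 by rewrite horner_prod (big_rem a af) /= hornerXsubC subrr mul0r.
  by rewrite mulr0 scale0r.
have szp : size p = (size p).-1.+1 by rewrite size_prod_XsubC.
rewrite szp big_ord_recl /= => /eqP; rewrite addr_eq0 => /eqP E.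
apply: (subspace_scale_cancel sR p0); rewrite E; apply: subspaceN => //.
by apply: subspace_sum => // j _ _; apply: subspaceZ => //; apply: iterE.
Qed.

Lemma arrangement_homog : exists e, forall N, B ^+ N \is (e * N).-hom.
Proof.
have [e he] : exists e, B \is e.-hom; last by exists e => N; apply: dhomogMn.
suff [e1 h1] : exists e, \prod_(q : 'I_n * 'I_n) linear_form k q.1 q.2 \is e.-hom.
  have hF : all_vars k n \is n.-hom.
    by rewrite /all_vars -mesymnnE; apply: dhomog_mesym.
  by exists (e1 + n)%N; apply: dhomogM.
elim/big_ind: _ => [|f g [e1 h1] [e2 h2]|q _]; first by exists 0%N; apply: dhomog1.
  by exists (e1 + e2)%N; apply: dhomogM.
by exists 1%N; apply: linear_form_homog.
Qed.

Lemma sym_part_graded S N : graded_subspace S -> graded_subspace (sym_part S N).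
Proof.
move=> [sS gS]; split; first exact: sym_part_subspace.
have [e he] := arrangement_homog; move=> d g Sg P sP.
rewrite [P](pihomog_partitionE (mf := mdeg) (leqnn (msize P))) [B ^+ N * _]mulr_sumr mulr_suml.
apply: subspace_sum => // c _ _.
have hom : B ^+ N * pihomog mdeg c P \is (e * N + c).-hom.
  by apply: dhomogM => //; apply: pihomogP.
have := gS (e * N + c + d)%N _ (Sg (pihomog mdeg c P) (pihomog_sym c sP)).
by rewrite (pihomogM _ _ hom) leq_addr addKn.
Qed.

Lemma sym_part_mul_closed S N : mul_closed (elementary_symmetric k n) (sym_part S N).
Proof.
move=> t /elementary_symmetricP[_ st _] f Sf P sP.
by rewrite mulrA -[B ^+ N * P * t]mulrA; apply: Sf; rewrite rpredM.
Qed.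

(** The index is at once the position in the chain and the power of [B], so one bound serves for
    both. *)
Lemma sym_part_stabilizes (S : nat -> V -> Prop) : increasing S ->
  (forall t, witt_closed u w (S t)) -> stabilizes (fun t => sym_part (S t) t).
Proof.
move=> incS cS; apply: (@noetherian_symmetric k n) => //.
- by move=> t f Sf; apply: (sym_part_le (leqnSn t)) => P sP; apply: incS; apply: Sf.
- by move=> t; apply: sym_part_graded; case: (cS t).
- by move=> t; apply: sym_part_mul_closed.
by move=> t _ ->; apply: subspace0; apply: sym_part_subspace; case: (cS t) => -[].
Qed.

Definition positive_support f := forall a, a \in msupp f -> forall i : 'I_n, (0 < a i)%N.

(** [sym_radical_mem] puts all B^N P B^J g into [S t] for some N, so [g] belongs to a member of the
    stationary chain of symmetric parts. *)
Lemma sym_part_recover (S : nat -> V -> Prop) J t g : increasing S ->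
  (forall t, witt_closed u w (S t)) -> (forall t f, S t f -> positive_support f) ->
  (forall j f, sym_part (S j) j f -> sym_part (S J) J f) ->
  S t (B ^+ J * g) -> sym_part (S J) J g.
Proof.
move=> incS cS posS HJ Sf.
have [N SN] := sym_radical_mem (cS t) (posS t _ Sf) Sf.
apply: (HJ (maxn t (N + J))); apply: (sym_part_le (leq_maxr _ _)) => P sP.
apply: (increasing_le incS (leq_maxl t _)); rewrite exprD.
by have := SN P sP; rewrite mulrACA mulrA.
Qed.

Lemma stabilizes_arrangement (S : nat -> V -> Prop) : increasing S ->
  (forall t, witt_closed u w (S t)) -> (forall t f, S t f -> positive_support f) ->
  exists N, stabilizes (fun t f => S t f /\ divides (B ^+ N) f).
Proof.
move=> incS cS posS; have [J HJ] := sym_part_stabilizes incS cS.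
exists J, J => t f [Sf [g fE]]; split; last by exists g.
have SJ : sym_part (S J) J g by apply: (sym_part_recover (t := t)); rewrite -?fE.
by have := SJ 1 (rpred1 _); rewrite mulr1 -fE.
Qed.

Lemma arrangement_neq0 N : B ^+ N != 0.
Proof.
rewrite expf_neq0 // mulf_neq0 //; apply/prodf_neq0 => i _; first exact: linear_form_neq0.
by have := linear_form_neq0 k i i; rewrite /linear_form eqxx.
Qed.

(** The constant chain already makes the power of [B] uniform. Then S cap (B^J) is B^J times the
    module [sym_part S J], and its series is a shift of a rational one. *)
Lemma rational_arrangement S : witt_closed u w S -> (forall f, S f -> positive_support f) ->
  exists N, rational_series (fun d => (hilbert (fun f => S f /\ divides (B ^+ N) f) d)%:R : rat).
Proof.
move=> cS posS; have incS : increasing (fun _ : nat => S) by [].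
have [J HJ] := sym_part_stabilizes incS (fun _ => cS).
have [gS _] := cS; have [sS _] := gS; exists J.
have gG := sym_part_graded J gS.
have [e he] := arrangement_homog.
have ratG := hilbert_symmetric_module gG (sym_part_mul_closed (N := J)).
have sT : is_subspace (fun f => S f /\ divides (B ^+ J) f).
  split=> [|a f g [Sf df] [Sg dg]].
    by split; apply: subspace0 => //; apply: divides_subspace.
  by split; [case: sS => _; apply|case: (divides_subspace (B ^+ J)) => _; apply].
apply: eq_rational_series (rational_series_shift (e * J) ratG) => d; rewrite /shift_series.
case: leqP => ed; last first.
  rewrite hilbert0 // => f [[_ [g fE]] hf]; rewrite -(pihomog_dE hf) fE.
  by rewrite (pihomogM _ _ (he J)) leqNgt ed.
rewrite -{2}(subnK ed); congr (_%:R); apply/esym.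
apply: (hilbert_mul _ (arrangement_neq0 J) (he J) gG sT) => f.
split=> [[Sf [g fE]]|[g Sg ->]].
  exists g => //; apply: (sym_part_recover (S := fun _ => S) (t := 0%N)) => //.
  by rewrite -fE.
split; last by exists g.
by have := Sg 1 (rpred1 _); rewrite mulr1.
Qed.

End SymmetricSubmodule.

(** * Induction on the number of variables *)

Section Coprimality.
Variables (k : fieldType) (n : nat).
Local Notation V := {mpoly k[n]}.
Local Notation form q := (linear_form k q.1 q.2).
Implicit Types (f g P : V) (q : 'I_n * 'I_n).

(** The form is prime: [restrict] maps to a domain, with kernel generated by the form. *)
Lemma divides_cancel q P e g : restrict q.1 q.2 P != 0 ->
  divides (form q ^+ e) (P * g) -> divides (form q ^+ e) g.
Proof.
move=> P0; elim: e g => [|e IH] g [h E]; first by exists g; rewrite mul1r.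
have [g1 gE] : exists g1, g = form q * g1.
  apply: restrict_eq0; have := congr1 (restrict q.1 q.2) E.
  rewrite exprS -mulrA !restrictM restrict_linear_form mul0r => /eqP.
  by rewrite mulf_eq0 (negbTE P0) => /eqP.
have [g2 g1E] : divides (form q ^+ e) g1.
  apply: IH; exists h; apply: (mulfI (linear_form_neq0 k q.1 q.2)).
  by rewrite mulrCA -gE E exprS mulrA.
by exists g2; rewrite gE g1E mulrA -exprS.
Qed.

(** The order conditions exclude opposite pairs, whose forms differ only by a sign. *)
Lemma restrict_form_neq0 q q' : (q.1 <= q.2)%N -> (q'.1 <= q'.2)%N -> q != q' ->
  restrict q.1 q.2 (form q') != 0.
Proof.
case: q q' => [i j] [i' j'] /= ij ij' ne.
have dX l l' : l != l' -> 'X_l - 'X_l' != 0 :> {mpoly k[n.-1]}.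
  by move=> ll'; have := linear_form_neq0 k l l'; rewrite /linear_form (negbTE ll').
have nX l : 'X_l != 0 :> {mpoly k[n.-1]}.
  by have := linear_form_neq0 k l l; rewrite /linear_form eqxx.
rewrite /linear_form; case: (eqVneq i' j') => [E|ne'].
  rewrite restrictXU /restrict_var; case: unliftP => [l _ //|Ei].
  by case: unliftP => [l _ //|Ej]; rewrite -E Ei Ej eqxx in ne.
rewrite rmorphB /= !restrictXU /restrict_var.
case: (unliftP i i') => [l Ei'|Ei']; case: (unliftP i j') => [l' Ej'|Ej'].
- by apply: dX; apply: contraNneq ne' => E; rewrite Ei' Ej' E.
- case: (unliftP i j) => [l1 Ej|_]; last by rewrite subr0.
  apply: dX; apply: contraNneq ne => E; have jE : j = i' by rewrite Ej Ei' E.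
  have le1 : (i <= i')%N by rewrite -jE.
  have le2 : (i' <= i)%N by rewrite -Ej'.
  have iE : i = i' by apply/val_inj/eqP; rewrite eqn_leq le1.
  by rewrite jE Ej' iE.
- case: (unliftP i j) => [l1 Ej|_]; last by rewrite sub0r oppr_eq0.
  by apply: dX; apply: contraNneq ne => E; rewrite Ei' Ej' Ej E.
by rewrite Ei' Ej' eqxx in ne'.
Qed.

Lemma divides_prod_forms (fs : seq ('I_n * 'I_n)) e f : uniq fs ->
  (forall q, q \in fs -> (q.1 <= q.2)%N) ->
  (forall q, q \in fs -> divides (form q ^+ e) f) ->
  divides (\prod_(q <- fs) form q ^+ e) f.
Proof.
elim: fs => [|q fs IH] /=; first by exists f; rewrite big_nil mul1r.
move=> /andP[qfs ufs] le dv.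
have [g fE] : divides (\prod_(q <- fs) form q ^+ e) f.
  by apply: IH => // q' q'fs; [apply: le|apply: dv]; rewrite inE q'fs orbT.
have [h gE] : divides (form q ^+ e) g.
  apply: (divides_cancel (P := \prod_(q <- fs) form q ^+ e)); last first.
    by rewrite -fE; apply: dv; apply: mem_head.
  rewrite rmorph_prod /= prodf_seq_neq0; apply/allP => q' q'fs /=.
  rewrite restrictXn expf_neq0 // restrict_form_neq0 ?le ?mem_head ?inE ?q'fs ?orbT //.
  by apply: contraNneq qfs => ->.
by exists h; rewrite big_cons fE gE mulrCA mulrA.
Qed.

Definition ordered_pairs : seq ('I_n * 'I_n) :=
  [seq q : 'I_n * 'I_n <- index_enum ('I_n * 'I_n : finType)%type | (q.1 <= q.2)%N].

(** [s] is the sign that arises from reversing the decreasing pairs. *)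
Lemma arrangement_square : exists s : V, s * s = 1 /\
  arrangement k n = s * (\prod_(q <- ordered_pairs) form q) ^+ 2.
Proof.
pose M := \prod_(q : 'I_n * 'I_n | (q.1 < q.2)%N) form q.
exists (\prod_(q : 'I_n * 'I_n | (q.1 < q.2)%N) (-1)); split.
  by rewrite -big_split /= big1 // => q _; rewrite mulrNN mulr1.
have diag : \prod_(q : 'I_n * 'I_n | q.1 == q.2) form q = all_vars k n.
  rewrite -(pair_big_dep predT (fun i j => i == j) (fun i j => linear_form k i j)) /=.
  apply: eq_bigr => i _; rewrite (eq_bigl (fun j => j == i)); last by move=> j; rewrite eq_sym.
  by rewrite big_pred1_eq /linear_form eqxx.
have ME : \prod_(q <- ordered_pairs) form q = M * all_vars k n.
  rewrite /ordered_pairs big_filter (bigID (fun q : 'I_n * 'I_n => q.1 < q.2)%N) /=.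
  congr (_ * _); first by apply: eq_bigl => q; rewrite andb_idl // => /ltnW.
  by rewrite -diag; apply: eq_bigl => q; rewrite -leqNgt -eqn_leq.
rewrite ME /arrangement (bigID (fun q : 'I_n * 'I_n => q.1 <= q.2)%N) /=.
rewrite -big_filter -/ordered_pairs ME.
have -> : \prod_(q : 'I_n * 'I_n | ~~ (q.1 <= q.2)%N) form q =
    \prod_(q : 'I_n * 'I_n | (q.1 < q.2)%N) (-1) * M.
  have inj : injective (fun q : 'I_n * 'I_n => (q.2, q.1)) by move=> [a b] [c d] [-> ->].
  rewrite (reindex_inj inj) /= -big_split /=; apply: eq_big => [q|q lt].
    by rewrite -ltnNge.
  rewrite /linear_form eq_sym; case: eqP => [E|_]; last by rewrite mulN1r opprB.
  by move: lt; rewrite E leqnn.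
ring.
Qed.

Lemma divides_arrangement J f :
  divides (arrangement k n ^+ J) f <->
  forall q, q \in ordered_pairs -> divides (form q ^+ (2 * J)) f.
Proof.
have [s [ss E]] := arrangement_square; split=> [[g ->] q qp|dv].
  have [C CE] : exists C, \prod_(q <- ordered_pairs) form q = form q * C.
    by rewrite (big_rem _ qp) /=; eexists.
  exists (s ^+ J * C ^+ (2 * J) * g).
  rewrite E CE !exprMn_comm; try exact: mulrC.
  by rewrite mul2n -addnn !exprD; ring.
have [||g ->] := divides_prod_forms (fs := ordered_pairs) (e := (2 * J)%N) (f := f) _ _ dv.
- by rewrite filter_uniq // index_enum_uniq.
- by move=> q; rewrite mem_filter => /andP[].
exists (s ^+ J * g); rewrite E exprMn_comm; last exact: mulrC.
rewrite -exprM prodrXl; set M := (\prod_(_ <- _) _) ^+ _.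
have sJ : s ^+ J * s ^+ J = 1 by rewrite -exprMn_comm ?ss ?expr1n //; apply: mulrC.
by rewrite mulrACA sJ mul1r.
Qed.

End Coprimality.

(** * Divisibility by all the variables *)

Section PositiveSupport.
Variables (k : fieldType) (n : nat).
Local Notation V := {mpoly k[n]}.
Implicit Types (f g : V) (S : V -> Prop).

Lemma positive_support_divides f :
  positive_support f <-> forall i, divides ('X_i) f.
Proof.
split=> [pos i|dv a af i].
  rewrite [f]mpolyE; apply: (subspace_sum (divides_subspace _)) => a af _.
  apply: subspaceZ; first exact: divides_subspace.
  exists 'X_[a - U_(i)]; rewrite -mpolyXD addmC submK // lep1mP -lt0n; exact: pos.
have [g fE] := dv i; move: af; rewrite fE mulrC (perm_mem (msuppMX _ _)).
by case/mapP => b _ ->; rewrite mnmDE mnm1E eqxx.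
Qed.

Definition coordinate_pairs : seq ('I_n * 'I_n) := [seq (i, i) | i <- enum 'I_n].

Lemma jet_filtration_positive S f :
  jet_filtration S coordinate_pairs 1 f <-> S f /\ positive_support f.
Proof.
rewrite positive_support_divides; split=> -[Sf dv]; split=> //.
  move=> i; have := dv (i, i); rewrite /linear_form eqxx expr1; apply.
  by apply/mapP; exists i; rewrite ?mem_enum.
by move=> q /mapP[i _ ->]; rewrite /linear_form eqxx expr1.
Qed.

End PositiveSupport.

(** * Trading weight 1 for weight 0 *)

Section Conversion.
Variables (k : fieldType) (n : nat) (u w : 'I_n -> nat).
Hypothesis k0 : [pchar k] =i pred0.
Local Notation V := {mpoly k[n]}.
Implicit Types (f g : V) (S : V -> Prop).

Definition untwist (i : 'I_n) : nat := if w i == 1%N then 0 else w i.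

Definition untwist_eigenvalue (a : 'X_{1..n}) : k :=
  \prod_i (if w i == 1%N then (a i + u i)%:R else 1).

(* f |-> df identifies functions modulo constants with 1-forms, hence the     *)
(* weight 1 with the weight 0.                                                *)
Lemma twisted_witt_untwist m f :
  twisted_witt u w m (diagonal_op untwist_eigenvalue f) =
  diagonal_op untwist_eigenvalue (twisted_witt u untwist m f).
Proof.
apply: (eq_linear_monomials (F := fun f => twisted_witt u w m (diagonal_op untwist_eigenvalue f))
  (G := fun f => diagonal_op untwist_eigenvalue (twisted_witt u untwist m f))) => [||a].
- apply: linear_compf (twisted_witt_linear _ _ _) (diagonal_op_linear _).
- apply: linear_compf (diagonal_op_linear _) (twisted_witt_linear _ _ _).
rewrite diagonal_opX (linear_funZ _ _ (twisted_witt_linear _ _ _)) !twisted_wittX.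
rewrite scaler_sumr linear_sum; apply: eq_bigr => i _ /=.
rewrite (linear_funZ _ _ (diagonal_op_linear _)) mpolyXn -mpolyXD diagonal_opX !scalerA.
congr (_ *: _); rewrite /untwist_eigenvalue !(bigD1 i (P := predT)) //= /untwist.
set p1 := \prod_(_ | _) _; set p2 := \prod_(_ | _) _.
have -> : p2 = p1.
  apply: eq_bigr => j ji; case: ifP => // _; congr (_%:R); congr (_ + _)%N.
  by rewrite mnmDE mulmnE mnm1E eq_sym (negbTE ji) mul0n.
case: (eqVneq (w i) 1%N) => [->|_]; last by rewrite mulrC !mul1r.
rewrite mnmDE mulmnE mnm1E eqxx !mul1n mul0n addn0 mulrA mulrAC.
by congr (_ * _%:R * _); lia.
Qed.

Lemma untwist_eigenvalue_neq0 f a : positive_support f -> a \in msupp f ->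
  untwist_eigenvalue a != 0.
Proof.
move=> pos af; apply/prodf_neq0 => i _; case: ifP => _; last exact: oner_neq0.
by rewrite char0_natr_eq0 //; have := pos a af i; lia.
Qed.

Lemma untwist_closed S : witt_closed u w S ->
  witt_closed u untwist (fun f => S (diagonal_op untwist_eigenvalue f)).
Proof.
move=> [[sS gS] cS]; split; [split; [split|]|].
- by rewrite linear0; apply: subspace0.
- by move=> a f g Sf Sg; rewrite diagonal_op_linear; case: sS => _; apply.
- move=> d f Sf; suff -> : diagonal_op untwist_eigenvalue (pihomog mdeg d f) =
      pihomog mdeg d (diagonal_op untwist_eigenvalue f) by apply: gS.
  apply: (eq_linear_monomials
     (F := fun f => diagonal_op untwist_eigenvalue (pihomog mdeg d f))
     (G := fun f => pihomog mdeg d (diagonal_op untwist_eigenvalue f))) => [||a].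
  + by apply: linear_compf (diagonal_op_linear _) (@pihomog_is_linear _ _ _ _).
  + by apply: linear_compf (@pihomog_is_linear _ _ _ _) (diagonal_op_linear _).
  rewrite diagonal_opX linearZ /= pihomogX; case: ifP => _; first by rewrite diagonal_opX.
  by rewrite linear0 scaler0.
by move=> m f m0 Sf; rewrite -twisted_witt_untwist; apply: cS.
Qed.

Lemma untwist_surj f : positive_support f -> exists2 g, positive_support g &
  f = diagonal_op untwist_eigenvalue g /\ forall d, f \is d.-hom -> g \is d.-hom.
Proof.
move=> pos; pose g := \sum_(a <- msupp f) ((untwist_eigenvalue a)^-1 * f@_a) *: 'X_[a].
have homX (a : 'X_{1..n}) : a \in msupp f -> forall i, divides 'X_i 'X_[a].
  move=> af; apply/positive_support_divides => b; rewrite msuppX inE => /eqP->; exact: pos.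
exists g.
  apply/positive_support_divides => i; apply: (subspace_sum (divides_subspace _)) => a af _.
  by apply: subspaceZ; [apply: divides_subspace|apply: homX].
split.
  rewrite /g linear_sum [LHS]mpolyE big_seq [RHS]big_seq; apply: eq_bigr => a af /=.
  rewrite (linear_funZ _ _ (diagonal_op_linear _)) diagonal_opX scalerA mulrAC mulVf ?mul1r //.
  exact: untwist_eigenvalue_neq0 pos af.
move=> d hf; rewrite /g big_seq; apply: rpred_sum => a af; apply: rpredZ.
by rewrite dhomogX; apply/eqP; apply: dhomog_mf hf _ af.
Qed.

Lemma diagonal_op_positive c f : positive_support f -> positive_support (diagonal_op c f).
Proof.
move=> pos; apply/positive_support_divides => i.
apply: (subspace_sum (divides_subspace _)) => a af _.
do 2!(apply: subspaceZ; first exact: divides_subspace).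
move: (i); apply/positive_support_divides => b; rewrite msuppX inE => /eqP->; exact: pos.
Qed.

Lemma diagonal_op_homog (c : 'X_{1..n} -> k) f d : f \is d.-hom -> diagonal_op c f \is d.-hom.
Proof.
move=> hf; rewrite /diagonal_op /monomial_lin big_seq; apply: rpred_sum => a af.
by do 2!apply: rpredZ; rewrite dhomogX; apply/eqP; apply: dhomog_mf hf _ af.
Qed.

Lemma untwist_inj f : positive_support f -> diagonal_op untwist_eigenvalue f = 0 -> f = 0.
Proof.
move=> pos E; apply/mpolyP => a; rewrite mcoeff0; apply/eqP.
case: (boolP (a \in msupp f)) => [af|]; last by rewrite -mcoeff_eq0.
have := congr1 (mcoeff a) E; rewrite mcoeff0 /diagonal_op /monomial_lin raddf_sum /=.
rewrite (bigD1_seq a) ?msupp_uniq //= !mcoeffZ mcoeffX eqxx mulr1 big1 ?addr0.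
  by move=> /eqP; rewrite mulf_eq0 (negbTE (untwist_eigenvalue_neq0 pos af)) orbF.
by move=> b ba; rewrite !mcoeffZ mcoeffX (negbTE ba) !mulr0.
Qed.

End Conversion.

(** * The induction *)

Section MainInduction.
Variable k : fieldType.
Hypothesis k0 : [pchar k] =i pred0.

Theorem witt_noetherian n u w : @chain_condition k n u w /\ @rational_condition k n u w.
Proof.
elim/ltn_ind: n u w => n IH u w.
have IHc : (0 < n)%N -> forall u' w', @chain_condition k n.-1 u' w'.
  by move=> n0 u' w'; have [] := IH n.-1 _ u' w'; rewrite ?prednK.
have IHr : (0 < n)%N -> forall u' w', @rational_condition k n.-1 u' w'.
  by move=> n0 u' w'; have [] := IH n.-1 _ u' w'; rewrite ?prednK.
have jetsE (S : {mpoly k[n]} -> Prop) N f :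
    jet_filtration S (ordered_pairs n) (2 * N) f <-> S f /\ divides (arrangement k n ^+ N) f.
  by rewrite /jet_filtration divides_arrangement.
pose w' := untwist w; have w1 i : w' i != 1%N by rewrite /w' /untwist; case: ifP => // ->.
(* The untwisting operator maps [T S] bijectively onto the elements of [S] divisible by every
   variable; the weights [w'] of [T S] avoid 1. *)
pose T S := @jet_filtration k n (fun f => S (diagonal_op (untwist_eigenvalue k u w) f))
   (coordinate_pairs n) 1.
have TP S f : T S f <-> S (diagonal_op (untwist_eigenvalue k u w) f) /\ positive_support f.
  exact: jet_filtration_positive.
split=> [S incS cS|S cS].
  apply: (stabilizes_of_jets IHc (u := u) (w := w) (fs := coordinate_pairs n) (e := 1) incS cS).
  have cT t : witt_closed u w' (T (S t)) by apply/jet_filtration_closed/untwist_closed.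
  have incT : increasing (fun t => T (S t)) by move=> t f /TP[Sf pos]; apply/TP; split=> //; apply: incS.
  have [|N [J HJ]] := stabilizes_arrangement k0 w1 incT cT; first by move=> t f /TP[].
  have [|J' HJ'] := stabilizes_of_jets IHc (fs := ordered_pairs n) (e := (2 * N)%N) incT cT.
    by exists J => t f /jetsE Tf; apply/jetsE; apply: HJ Tf.
  exists J' => t f /jet_filtration_positive[Sf pos]; apply/jet_filtration_positive; split=> //.
  have [g posg [fE _]] := untwist_surj u w k0 pos.
  by rewrite fE; have /TP[] : T (S J') g by apply: (HJ' t); apply/TP; rewrite -fE.
apply: (rational_of_jets IHr (u := u) (w := w) (fs := coordinate_pairs n) (e := 1) cS).
have cT : witt_closed u w' (T S) by apply/jet_filtration_closed/untwist_closed.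
have [[sT gT] _] := cT.
have sC : is_subspace (jet_filtration S (coordinate_pairs n) 1).
  by have [[]] := jet_filtration_closed (coordinate_pairs n) 1 cS.
have ratT : rational_series (fun d => (hilbert (T S) d)%:R : rat).
  have [|N ratN] := rational_arrangement k0 w1 cT; first by move=> f /TP[].
  apply: (rational_of_jets IHr (fs := ordered_pairs n) (e := (2 * N)%N) cT).
  apply: eq_rational_series ratN => d; congr (_%:R); apply: eq_hilbert.
  - split=> [|a f g [Sf df] [Sg dg]].
      by split; apply: subspace0 => //; apply: divides_subspace.
    by split; [case: sT => _; apply|case: (divides_subspace (arrangement k n ^+ N)) => _; apply].
  - by have [[]] := jet_filtration_closed (ordered_pairs n) (2 * N) cT.
  by move=> f; split=> -[/jetsE].
apply: eq_rational_series ratT => d; congr (_%:R); apply/esym.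
apply: (@hilbert_inj k n n (diagonal_op (untwist_eigenvalue k u w))) => //.
  by move=> f /TP[_ pos]; apply: untwist_inj.
move=> f; split=> [[/jet_filtration_positive[Sf pos] hf]|[g [/TP[Sg pos] hg] ->]].
  have [g posg [fE homg]] := untwist_surj u w k0 pos.
  by exists g => //; split; [apply/TP; rewrite -fE|apply: homg].
split; last exact: diagonal_op_homog.
by apply/jet_filtration_positive; split=> //; apply: diagonal_op_positive.
Qed.

End MainInduction.

(** * Polynomial substitutions *)

Section Substitutions.
Variables (k : fieldType) (n : nat).
Hypothesis k0 : [pchar k] =i pred0.
Local Notation V := {mpoly k[n]}.
Implicit Types (f g : V) (S : V -> Prop).

Lemma subst_poly_scale (t : k) f N : (msize f <= N)%N ->
  subst_poly (t *: 'X) f = \sum_(d < N) t ^+ d *: pihomog mdeg d f.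
Proof.
move=> fN; rewrite {1}[f](pihomog_partitionE (mf := mdeg) fN) /subst_poly linear_sum /=.
apply: eq_bigr => d _; have := pihomogP mdeg d f; set g := pihomog _ _ _ => hg.
rewrite [in LHS](mpolyE g) linear_sum [in RHS](mpolyE g) scaler_sumr.
rewrite big_seq [RHS]big_seq; apply: eq_bigr => m mg /=.
rewrite linearZ /= scalerA mulrC -scalerA; congr (_ *: _).
rewrite comp_mpolyX (eq_bigr (fun i => (t ^+ m i)%:MP * 'X_i ^+ m i)) => [|i _]; last first.
  rewrite tnth_mktuple map_polyZ /= map_polyX hornerZ hornerX exprMn_comm; last exact: mulrC.
  by rewrite rmorphXn.
rewrite big_split /= -mpolyXE_id -rmorph_prod /= mul_mpolyC; congr (_ *: _).
have dE : mdeg m = d by apply: dhomog_mf hg _ mg.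
by rewrite -dE mdegE prodrXr.
Qed.

Section Flow.
Variables (m : nat) (flow : {rmorphism V -> {poly V}}).
Hypothesis flowC : forall c, flow c%:MP = (c%:MP)%:P.
Hypothesis flowXU : forall i, flow 'X_i = ('X_i)%:P + 'X_i ^+ m.+1 *: 'X.

(** The flow is the substitution x -> x + t x^(m+1) with t kept formal. *)
Lemma flow_eval (t : k) f : (flow f).[t%:MP] = subst_poly ('X + t *: 'X^(m.+1)) f.
Proof.
elim/mpoly_alg_ind: f => [c|i|f g Ef Eg|f g Ef Eg].
- by rewrite flowC hornerC /subst_poly comp_mpolyC.
- rewrite flowXU /subst_poly comp_mpolyXU -tnth_nth tnth_mktuple.
  rewrite rmorphD /= map_polyX map_polyZ /= map_polyXn !hornerE.
  by rewrite mulrC.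
- by rewrite rmorphD hornerD Ef Eg /subst_poly comp_mpolyD.
by rewrite rmorphM hornerM Ef Eg /subst_poly rmorphM.
Qed.

Lemma flow_coef f : (flow f)`_0 = f /\ (flow f)`_1 = witt m f.
Proof.
elim/mpoly_alg_ind: f => [c|i|f g [f0 f1] [g0 g1]|f g [f0 f1] [g0 g1]].
- rewrite flowC !coefC /=; split=> //; rewrite /witt big1 // => i _.
  by rewrite eulerC mulr0.
- rewrite flowXU !coefD !coefC !coefZ !coefX /= mulr0 mulr1 addr0 add0r; split=> //.
  rewrite /witt (bigD1 i) //= eulerXU eqxx scale1r -exprSr big1 ?addr0 // => j ji.
  by rewrite eulerXU (negbTE ji) scale0r mulr0.
- by rewrite rmorphD !coefD f0 f1 g0 g1 linearD.
rewrite rmorphM !coefM !big_ord_recl !big_ord0 /= f0 f1 g0 g1 wittM !addr0.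
by split=> //; rewrite addrC.
Qed.

End Flow.

Lemma flow_exists m : exists flow : {rmorphism V -> {poly V}},
  (forall c, flow c%:MP = (c%:MP)%:P) /\
  (forall i, flow 'X_i = ('X_i)%:P + 'X_i ^+ m.+1 *: 'X).
Proof.
exists (mmap (polyC \o @mpolyC n k) (fun i => ('X_i)%:P + 'X_i ^+ m.+1 *: 'X)).
by split=> [c|i] /=; rewrite ?mmapC // mmapX mmap1U.
Qed.

Lemma subst_closed_witt S : is_subspace S -> subst_closed S ->
  witt_closed (fun=> 0%N) (fun=> 0%N) S.
Proof.
move=> sS cS; split; [split=> // d f Sf|move=> m f m0 Sf].
  case: (ltnP d (msize f)) => df; last first.
    rewrite (_ : pihomog mdeg d f = 0); first exact: subspace0.
    rewrite /pihomog big_seq_cond big1 // => a /andP[/msize_mdeg_lt lt /eqP ad].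
    by rewrite ad ltnNge df in lt.
  apply: (polynomial_values_coef k0 sS (c := fun d => pihomog mdeg d f) _ df) => a _.
  rewrite -subst_poly_scale //; apply: cS => //.
  by rewrite hornerZ hornerX mulr0.
rewrite /twisted_witt /twist big1 ?mul0r ?addr0 => [|i _]; last by rewrite scale0r.
have [flow [flowC flowXU]] := flow_exists m.
(* The bound 2 keeps the index 1 in range when the flow of [f] is constant. *)
have [_ <-] := flow_coef flowC flowXU f; pose N := maxn 2 (size (flow f)).
apply: (polynomial_values_coef k0 sS (c := fun j => (flow f)`_j) (N := N)); last by rewrite leq_maxl.
move=> a _; suff -> : \sum_(j < N) a%:R ^+ j *: (flow f)`_j = subst_poly ('X + a%:R *: 'X^(m.+1)) f.
  by apply: cS => //; rewrite !hornerE expr0n mulr0.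
rewrite -(flow_eval flowC flowXU) (horner_coef_wide _ (leq_maxr 2 _)); apply: eq_bigr => j _.
by rewrite -mul_mpolyC mulrC; congr (_ * _); apply: rmorphXn.
Qed.

Lemma homog_part_direct_sum S : graded_subspace S -> is_direct_sum S (homog_part S).
Proof.
move=> [sS gS]; split=> [f|m g hg sum0 d dm].
  split=> [Sf|[m [g [hg ->]]]]; last by apply: subspace_sum => // d _ _; case: (hg d).
  exists (msize f), (fun d => pihomog mdeg d f); split.
    by move=> d; split; [apply: gS|apply: pihomogP].
  exact: pihomog_partitionE.
have := congr1 (pihomog mdeg d) sum0; rewrite linear_sum linear0 (bigD1 (Ordinal dm)) //=.
rewrite pihomog_dE; last by case: (hg d).
rewrite big1 ?addr0 // => i ne; apply: pihomog_ne0 (proj2 (hg i)).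
by apply: contraNneq ne => E; apply/eqP/val_inj.
Qed.

Definition witt_span (T : seq V) f := forall U : V -> Prop,
  witt_closed (fun=> 0%N) (fun=> 0%N) U -> (forall g, g \in T -> U g) -> U f.

Lemma witt_span_closed T : witt_closed (fun=> 0%N) (fun=> 0%N) (witt_span T).
Proof.
split; [split; [split|]|].
- by move=> U [[sU _] _] _; apply: subspace0.
- move=> a f g Sf Sg U cU TU; have [[[_ UD] _] _] := cU.
  by apply: UD; [apply: Sf|apply: Sg].
- by move=> d f Sf U cU TU; have [[_ gU] _] := cU; apply: gU; apply: Sf.
by move=> m f m0 Sf U cU TU; have [_ wU] := cU; apply: wU => //; apply: Sf.
Qed.

Lemma witt_span_mem T f : f \in T -> witt_span T f.
Proof. by move=> fT U _; apply. Qed.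

(** Otherwise generators can be chosen one after another, each outside the span of the earlier ones,
    and the spans never become stationary. *)
Lemma witt_finitely_generated S : witt_closed (fun=> 0%N) (fun=> 0%N) S ->
  exists T : seq V, (forall g, g \in T -> S g) /\ forall f, S f -> witt_span T f.
Proof.
move=> cS; apply: NNPP => notfg.
have next (T : seq V) : {f | (forall g, g \in T -> S g) -> S f /\ ~ witt_span T f}.
  apply: constructive_indefinite_description.
  case: (classic (forall g, g \in T -> S g)) => [TS|nTS]; last by exists 0.
  have : ~ forall f, S f -> witt_span T f by move=> H; apply: notfg; exists T.
  by move=> /not_all_ex_not[f Hf]; exists f => _; apply: imply_to_and.
pose T := fix T (j : nat) : seq V := if j is j'.+1 then sval (next (T j')) :: T j' else [::].
have TS j : forall g, g \in T j -> S g.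
  elim: j => [|j IH] g //=; rewrite inE => /predU1P[->|/IH //].
  by case: (svalP (next (T j)) IH).
have [|j|J HJ] := (witt_noetherian k0 (fun=> 0%N) (fun=> 0%N)).1 (fun j => witt_span (T j)).
- move=> j f Tf U cU TU; apply: Tf => // g gT; apply: TU; by rewrite /= inE gT orbT.
- exact: witt_span_closed.
case: (svalP (next (T J)) (TS J)) => _; apply; apply: (HJ J.+1).
by apply: witt_span_mem; apply: mem_head.
Qed.

End Substitutions.

Theorem corollary3p3p1 (k : fieldType) (k_char0 : [pchar k] =i pred0)
    (n : nat) (S : {mpoly k[n.+1]} -> Prop)
    (S_subspace : is_subspace S) (S_closed : subst_closed S) :
  is_direct_sum S (homog_part S) /\
  (exists T : seq {mpoly k[n.+1]},
     (forall g, g \in T -> S g) /\ (forall f, S f <-> subst_span T f)) /\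
  (exists V : forall d : nat, {vspace dhomog n.+1 k d},
     (forall (d : nat) (v : dhomog n.+1 k d),
        v \in V d <-> homog_part S d (mpoly_of_dhomog v)) /\
     rational_series (fun d : nat => (\dim (V d))%:R : rat)).
Proof.
have cS := subst_closed_witt k_char0 S_subspace S_closed; split; last split.
- by apply: homog_part_direct_sum; case: cS.
- have [T [TS ST]] := witt_finitely_generated k_char0 cS.
  (* A substitution-closed subspace is stable under the Witt operators, so generators for these also
     generate by substitutions. *)
  exists T; split=> // f; split=> [Sf U sU cU TU|]; last by apply.
  by apply: ST => //; apply: subst_closed_witt.
pose V d := vspace_of (fun v : dhomog n.+1 k d => homog_part S d (mpoly_of_dhomog v)).
have VP d (v : dhomog n.+1 k d) : v \in V d <-> homog_part S d (mpoly_of_dhomog v).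
  have [H0 HD] := homog_part_subspace d S_subspace.
  by apply: vspace_ofP; split=> [|a x y Sx Sy]; [rewrite linear0|rewrite linearP; apply: HD].
exists V; split=> //.
have := (witt_noetherian k_char0 (fun=> 0%N) (fun=> 0%N)).2 S cS.
by apply: eq_rational_series => d; rewrite (hilbert_dimv S_subspace (VP d)).
Qed.
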